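(* Let $\mathcal{A}$ be any first-order structure with universe $U_{\mathcal{A}}$, and let $Q\subseteq U_{\mathcal{A}}^\infty$ with $Q\in\mathrm{SDEC}_{\mathcal{A}}$. Then $\{\mathrm{Res}_{\mathcal{M}}\mid \mathcal{M}\in \mathsf{M}_{\mathcal{A}}^\nu(Q)\}\subseteq \{\mathrm{Res}_{\mathcal{M}}\mid \mathcal{M}\in \mathsf{M}_{\mathcal{A}}^{\mathrm{ND}}\}$. Moreover, for $Q=U_{\mathcal{A}}^\infty$, $\{\mathrm{Res}_{\mathcal{M}}\mid \mathcal{M}\in \mathsf{M}_{\mathcal{A}}^\nu(Q)\}= \{\mathrm{Res}_{\mathcal{M}}\mid \mathcal{M}\in \mathsf{M}_{\mathcal{A}}^{\mathrm{ND}}\}$.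
   Context: A first-order structure $\mathcal{A}=(U_{\mathcal{A}};(c_i)_{i};(f_i)_{i};(r_i)_{i})$ has a universe, constants, functions and relations (the identity relation need not be among them). $U_{\mathcal{A}}^\infty=\bigcup_{n\ge1}U_{\mathcal{A}}^n$. A (deterministic) BSS RAM over $\mathcal{A}$ has $Z$-registers $Z_1,Z_2,\dots$ (elements of $U_{\mathcal{A}}$), finitely many index registers $I_1,\dots,I_k$ (positive integers), and a program: a finite sequence of labeled instructions $1,\dots,\ell_{\mathcal P}$, the last being the only stop instruction, of the types: $Z_j:=f_i(Z_{j_1},\dots,Z_{j_{m_i}})$; $Z_j:=c_i$; $Z_{I_j}:=Z_{I_k}$; if $r_i(Z_{j_1},\dots,Z_{j_{k_i}})$ then goto $\ell_1$ else goto $\ell_2$; if $I_j=I_k$ then goto $\ell_1$ else goto $\ell_2$; $I_j:=1$; $I_j:=I_j+1$; stop. Configurations are $(\ell,\nu_1,\dots,\nu_k,u_1,u_2,\dots)$. On input $\vec x=(x_1,\dots,x_n)$ the initial configuration is $(1,(n,1,\dots,1),(x_1,\dots,x_n,x_n,x_n,\dots))$; at the stop label the output is $(u_1,\dots,u_{\nu_1})$. $\mathrm{SDEC}_{\mathcal{A}}$ is the class of halting sets of deterministic BSS RAMs over $\mathcal{A}$. $\mathsf{M}_{\mathcal{A}}^{\mathrm{ND}}$ is the class of non-deterministic BSS RAMs over $\mathcal{A}$: like deterministic ones except that on input $\vec x$ every configuration $(1,(n,1,\dots,1),(x_1,\dots,x_n,y_1,\dots,y_m,x_n,x_n,\dots))$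 with $m\ge1$ and arbitrary $(y_1,\dots,y_m)\in U_{\mathcal{A}}^m$ is an admissible initial configuration. For $Q\subseteq U_{\mathcal{A}}^\infty$, $\nu[Q](\vec z)=\{y_1\in U_{\mathcal{A}}\mid \exists m\ge1\ \exists y_2,\dots,y_m:\ (\vec z,y_1,\dots,y_m)\in Q\}$. $\mathsf{M}_{\mathcal{A}}^\nu(Q)$ is the class of $\nu$-oracle BSS RAMs over $\mathcal{A}$: BSS RAMs with deterministic input procedure that may additionally use instructions $Z_j:=\nu[Q](Z_1,\dots,Z_{I_1})$, which set $Z_j$ to an arbitrarily chosen element of $\nu[Q](u_1,\dots,u_{\nu_1})$ (current contents of $Z_1,\dots,Z_{\nu_1}$, $\nu_1$ the content of $I_1$), and loop forever if this set is empty. For a machine $\mathcal{M}$ of either kind, the result function $\mathrm{Res}_{\mathcal{M}}:U_{\mathcal{A}}^\infty\to\mathfrak{P}(U_{\mathcal{A}}^\infty)$ maps $\vec x$ to the set of all outputs of halting computations of $\mathcal{M}$ on input $\vec x$ (over all admissible initial configurations and all non-deterministic choices). *)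

(* Defs.v *)
From Stdlib Require Import List Arith Relations Fin.
Import ListNotations.


Record structure := {
  univ : Type;
  cidx : Type;
  cval : cidx -> univ;
  fidx : Type;
  farity : fidx -> nat;
  fval : forall i : fidx, (Fin.t (farity i) -> univ) -> univ;
  ridx : Type;
  rarity : ridx -> nat;
  rval : forall i : ridx, (Fin.t (rarity i) -> univ) -> Prop
}.

Section BSS.
Variable A : structure.
Notation U := (univ A).

(** Elements of U^infty are represented by non-empty lists. *)
Definition Uinf (x : list U) : Prop := x <> [].

(** * Instructions.
    Z-register indices and index-register indices are the paper's
    (1-based) indices; labels are 1-based. *)
Inductive instr : Type :=
| IFun (j : nat) (i : fidx A) (args : Fin.t (farity A i) -> nat)
    (* Z_j := f_i(Z_{args 1},...,Z_{args m_i}) *)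
| IConst (j : nat) (i : cidx A)                 (* Z_j := c_i *)
| ICopy (j k : nat)                             (* Z_{I_j} := Z_{I_k} *)
| IRel (i : ridx A) (args : Fin.t (rarity A i) -> nat) (l1 l2 : nat)
    (* if r_i(Z_{args ..}) then goto l1 else goto l2 *)
| IIdxEq (j k l1 l2 : nat)                      (* if I_j = I_k then goto l1 else goto l2 *)
| ISet1 (j : nat)                               (* I_j := 1 *)
| IIncr (j : nat)                               (* I_j := I_j + 1 *)
| IStop
| IOracle (j : nat).                            (* Z_j := nu[Q](Z_1,...,Z_{I_1}) *)

Record machine := { nidx : nat; prog : list instr }.

Definition wf_zreg (j : nat) : Prop := 1 <= j.
Definition wf_ireg (M : machine) (j : nat) : Prop := 1 <= j <= nidx M.
Definition wf_lab (M : machine) (l : nat) : Prop := 1 <= l <= length (prog M).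

Definition wf_instr (oracle_ok : bool) (M : machine) (ins : instr) : Prop :=
  match ins with
  | IFun j i args => wf_zreg j /\ forall t, wf_zreg (args t)
  | IConst j _ => wf_zreg j
  | ICopy j k => wf_ireg M j /\ wf_ireg M k
  | IRel i args l1 l2 => (forall t, wf_zreg (args t)) /\ wf_lab M l1 /\ wf_lab M l2
  | IIdxEq j k l1 l2 => wf_ireg M j /\ wf_ireg M k /\ wf_lab M l1 /\ wf_lab M l2
  | ISet1 j => wf_ireg M j
  | IIncr j => wf_ireg M j
  | IStop => True
  | IOracle j => oracle_ok = true /\ wf_zreg j
  end.

Definition is_stop (ins : instr) : Prop :=
  match ins with IStop => True | _ => False end.

(** The last instruction is the only stop instruction; at least one index
    register (I_1 is used for input/output). *)
Definition wf_machine (oracle_ok : bool) (M : machine) : Prop :=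
  1 <= nidx M /\
  (exists P, prog M = P ++ [IStop] /\ forall ins, In ins P -> ~ is_stop ins) /\
  (forall ins, In ins (prog M) -> wf_instr oracle_ok M ins).

(** * Configurations (label, index registers nu_1..nu_k, Z-registers u_1,u_2,...).
    Register values are stored at their (1-based) index; position 0 is unused. *)
Record config := { lab : nat; ireg : nat -> nat; zreg : nat -> U }.

Definition upd {X : Type} (f : nat -> X) (j : nat) (v : X) : nat -> X :=
  fun k => if Nat.eqb k j then v else f k.

Definition out (c : config) : list U := map (zreg c) (seq 1 (ireg c 1)).

(** Execution of a (non-stop) instruction at the current label.
    [O z y] : y is an admissible answer of the oracle on query z. *)
Inductive exec (O : list U -> U -> Prop) : instr -> config -> config -> Prop :=
| ExFun : forall j i args c,
    exec O (IFun j i args) c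
      {| lab := S (lab c); ireg := ireg c;
         zreg := upd (zreg c) j (fval A i (fun t => zreg c (args t))) |}
| ExConst : forall j i c,
    exec O (IConst j i) c
      {| lab := S (lab c); ireg := ireg c; zreg := upd (zreg c) j (cval A i) |}
| ExCopy : forall j k c,
    exec O (ICopy j k) c
      {| lab := S (lab c); ireg := ireg c;
         zreg := upd (zreg c) (ireg c j) (zreg c (ireg c k)) |}
| ExRelT : forall i args l1 l2 c,
    rval A i (fun t => zreg c (args t)) ->
    exec O (IRel i args l1 l2) c {| lab := l1; ireg := ireg c; zreg := zreg c |}
| ExRelF : forall i args l1 l2 c,
    ~ rval A i (fun t => zreg c (args t)) ->
    exec O (IRel i args l1 l2) c {| lab := l2; ireg := ireg c; zreg := zreg c |}
| ExIdxT : forall j k l1 l2 c,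
    ireg c j = ireg c k ->
    exec O (IIdxEq j k l1 l2) c {| lab := l1; ireg := ireg c; zreg := zreg c |}
| ExIdxF : forall j k l1 l2 c,
    ireg c j <> ireg c k ->
    exec O (IIdxEq j k l1 l2) c {| lab := l2; ireg := ireg c; zreg := zreg c |}
| ExSet1 : forall j c,
    exec O (ISet1 j) c
      {| lab := S (lab c); ireg := upd (ireg c) j 1; zreg := zreg c |}
| ExIncr : forall j c,
    exec O (IIncr j) c
      {| lab := S (lab c); ireg := upd (ireg c) j (S (ireg c j)); zreg := zreg c |}
| ExOracle : forall j c y,
    O (out c) y ->
    exec O (IOracle j) c
      {| lab := S (lab c); ireg := ireg c; zreg := upd (zreg c) j y |}.

Definition step (O : list U -> U -> Prop) (M : machine) (c c' : config) : Prop :=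
  1 <= lab c /\
  exists ins, nth_error (prog M) (lab c - 1) = Some ins /\ exec O ins c c'.

Definition reach (O : list U -> U -> Prop) (M : machine) : config -> config -> Prop :=
  clos_refl_trans config (step O M).

Definition fill (s : list U) (d : U) : nat -> U := fun k => nth (k - 1) s d.

Definition init_idx (n : nat) : nat -> nat := fun j => if Nat.eqb j 1 then n else 1.

Definition init_det (x : list U) (c : config) : Prop :=
  match x with
  | [] => False
  | a :: _ => c = {| lab := 1; ireg := init_idx (length x); zreg := fill x (last x a) |}
  end.

Definition init_nd (x : list U) (c : config) : Prop :=
  match x with
  | [] => False
  | a :: _ => exists y : list U, y <> [] /\
      c = {| lab := 1; ireg := init_idx (length x); zreg := fill (x ++ y) (last x a) |}
  end.

(** Halting computations and their outputs (stop label = length of program). *)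
Definition Res_gen (O : list U -> U -> Prop) (init : list U -> config -> Prop)
  (M : machine) (x y : list U) : Prop :=
  exists c0 c, init x c0 /\ reach O M c0 c /\ lab c = length (prog M) /\ y = out c.

Definition halts_det (M : machine) (x : list U) : Prop :=
  exists c0 c, init_det x c0 /\ reach (fun _ _ => False) M c0 c /\ lab c = length (prog M).

Definition SDEC (Q : list U -> Prop) : Prop :=
  exists M, wf_machine false M /\ forall x, Q x <-> halts_det M x.

Definition nuQ (Q : list U -> Prop) (z : list U) (y1 : U) : Prop :=
  exists rest : list U, Q (z ++ y1 :: rest).

Definition ND_machine (M : machine) : Prop := wf_machine false M.
Definition Res_ND (M : machine) : list U -> list U -> Prop :=
  Res_gen (fun _ _ => False) init_nd M.

Definition nu_machine (M : machine) : Prop := wf_machine true M.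
Definition Res_nu (Q : list U -> Prop) (M : machine) : list U -> list U -> Prop :=
  Res_gen (nuQ Q) init_det M.

End BSS.

(* Main.v *)
(** An oracle machine is simulated by a non-deterministic one that reads the answers of its
    oracle from the guessed part of the tape.  Since nothing but elements of the universe can be
    guessed (and they cannot even be compared), neither the length [m] of a witness
    [(y_1, ..., y_m)] nor the running time of the machine for [Q] is guessed: the [k]-th query
    dovetails over both, testing the prefixes of the [k]-th guessed stream, and returns the first
    element of the stream once some prefix is accepted.  Conversely, an oracle for the full set
    guesses single elements, and the guessed tape is produced on demand, one cell per simulated
    step, because a computation of [t] steps only sees [t] cells beyond the initially
    reachable ones.  The infinite padding of the tapes of deterministic machines by their last
    input is produced in the same way.

    The simulating programs are written in a while language whose addresses are polynomials in
    the index registers, the simulated tapes being interleaved modulo 4; this language is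
    compiled, in two stages, to the jump programs of BSS RAMs. *)
From Stdlib Require Import List Arith Relations Lia Classical FunctionalExtensionality.
Require Import Defs.
Import ListNotations.

Local Arguments lab {A}.
Local Arguments ireg {A}.
Local Arguments zreg {A}.
Local Arguments prog {A}.
Local Arguments nidx {A}.
Local Arguments exec {A}.
Local Arguments step {A}.
Local Arguments reach {A}.
Local Arguments out {A}.
Local Arguments IFun {A}.
Local Arguments IConst {A}.
Local Arguments ICopy {A}.
Local Arguments IRel {A}.
Local Arguments IIdxEq {A}.
Local Arguments ISet1 {A}.
Local Arguments IIncr {A}.
Local Arguments IStop {A}.
Local Arguments IOracle {A}.

(** Only the copy instruction addresses registers indirectly; functions, constants, relations and
    the oracle act on registers fixed in the program. The layout 4 * a + r therefore maps fixed
    registers to fixed registers, residue 0 leaves room for the auxiliary cell [Z_8], and whatever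
    must go to a computed place (a guessed element, a padding cell) is moved there by a copy. Index
    registers can only be reset, incremented and compared, so polynomial addresses are computed by
    counting loops, and all values stay at least 1.

    Two devices shorten the correctness proofs. An arbitrary infinite tape extending the input
    stands for the guessed tuple, because a halting run inspects only finitely many cells. And
    commands without oracle calls are deterministic, so exhibiting one outcome with a property
    proves it for every outcome; terminating parts are thus verified once for both directions, and
    only possibly divergent loops need a separate soundness argument. *)

Lemma upd_eq {X : Type} (f : nat -> X) j v : upd f j v j = v.
Proof. unfold upd. now rewrite Nat.eqb_refl. Qed.

Lemma upd_neq {X : Type} (f : nat -> X) j v k : k <> j -> upd f j v k = f k.
Proof. intros H. unfold upd. now apply Nat.eqb_neq in H as ->. Qed.

Ltac upds := repeat first [rewrite upd_eq | rewrite upd_neq by lia].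

Section Structure.
Context {A : structure}.
Local Notation U := (univ A).

(** Step counts serve as induction measure for loops and bound the number of cells that a run can
    inspect. *)
Fixpoint nsteps (O : list U -> U -> Prop) (M : machine A) (n : nat) (c c' : config A) : Prop :=
  match n with
  | 0 => c = c'
  | S n => exists c1, step O M c c1 /\ nsteps O M n c1 c'
  end.

Lemma reach_nsteps O M c c' : reach O M c c' <-> exists n, nsteps O M n c c'.
Proof.
  split.
  - intros H. apply clos_rt_rt1n in H. induction H as [|x y z Hs _ [n IH]].
    + now exists 0.
    + exists (S n), y. auto.
  - intros [n H]. revert c H. induction n as [|n IH]; simpl; intros c H.
    + subst. apply rt_refl.
    + destruct H as (c1 & Hs & H). apply rt_trans with c1; [now apply rt_step | now apply IH].
Qed.

(** * A while language over the registers, compiled to programs with jumps *)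

Definition state : Type := ((nat -> nat) * (nat -> U))%type.
Definition mk (l : nat) (s : state) : config A :=
  {| lab := l; ireg := fst s; zreg := snd s |}.
Definition st (c : config A) : state := (ireg c, zreg c).

Inductive test : Type :=
| TEq (j k : nat)
| TRel (i : ridx A) (args : Fin.t (rarity A i) -> nat).

Definition holds (t : test) (s : state) : Prop :=
  match t with
  | TEq j k => fst s j = fst s k
  | TRel i args => rval A i (fun t => snd s (args t))
  end.

Definition branch (t : test) (l1 l2 : nat) : instr A :=
  match t with
  | TEq j k => IIdxEq j k l1 l2
  | TRel i args => IRel i args l1 l2
  end.

Definition atom_den (O : list U -> U -> Prop) (a : instr A) (s s' : state) : Prop :=
  match a with
  | IFun j i args => s' = (fst s, upd (snd s) j (fval A i (fun t => snd s (args t))))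
  | IConst j i => s' = (fst s, upd (snd s) j (cval A i))
  | ICopy j k => s' = (fst s, upd (snd s) (fst s j) (snd s (fst s k)))
  | ISet1 j => s' = (upd (fst s) j 1, snd s)
  | IIncr j => s' = (upd (fst s) j (S (fst s j)), snd s)
  | IOracle j => exists y, O (out (mk 0 s)) y /\ s' = (fst s, upd (snd s) j y)
  | _ => False
  end.

Inductive lcmd : Type :=
| LSkip
| LAtom (a : instr A)
| LSeq (c1 c2 : lcmd)
| LIf (t : test) (c1 c2 : lcmd)
| LUntil (t : test) (c : lcmd).

(** The semantics is relational: a diverging loop has no final state, just as a diverging machine
    never reaches the stop label. *)
Fixpoint lden (O : list U -> U -> Prop) (c : lcmd) (s s' : state) : Prop :=
  match c with
  | LSkip => s' = s
  | LAtom a => atom_den O a s s'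
  | LSeq c1 c2 => exists s1, lden O c1 s s1 /\ lden O c2 s1 s'
  | LIf t c1 c2 => holds t s /\ lden O c1 s s' \/ ~ holds t s /\ lden O c2 s s'
  | LUntil t c =>
      clos_refl_trans_1n state (fun a b => ~ holds t a /\ lden O c a b) s s' /\ holds t s'
  end.

Fixpoint csize (c : lcmd) : nat :=
  match c with
  | LSkip => 0
  | LAtom _ => 1
  | LSeq c1 c2 => csize c1 + csize c2
  | LIf _ c1 c2 => csize c1 + csize c2 + 2
  | LUntil _ c => csize c + 2
  end.

(** Comparing [I_1] with itself gives an unconditional jump; this is why at least one index register
    is demanded in [code_wf]. *)
Definition goto (l : nat) : instr A := IIdxEq 1 1 l l.

(** The block occupies the labels from [b] to [b + csize c - 1] and is left only through the label
    [b + csize c]. *)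
Fixpoint code (c : lcmd) (b : nat) : list (instr A) :=
  match c with
  | LSkip => []
  | LAtom a => [a]
  | LSeq c1 c2 => code c1 b ++ code c2 (b + csize c1)
  | LIf t c1 c2 =>
      branch t (b + 1) (b + csize c1 + 2) :: code c1 (b + 1) ++
      goto (b + csize c1 + csize c2 + 2) :: code c2 (b + csize c1 + 2)
  | LUntil t c => branch t (b + csize c + 2) (b + 1) :: code c (b + 1) ++ [goto b]
  end.

Fixpoint lwf (ok : bool) (K : nat) (c : lcmd) : Prop :=
  let wfi j := 1 <= j <= K in
  let wft t := match t with
    | TEq j k => wfi j /\ wfi k
    | TRel i args => forall t, 1 <= args t
    end in
  match c with
  | LSkip => True
  | LAtom a =>
      match a with
      | IFun j i args => 1 <= j /\ forall t, 1 <= args t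
      | IConst j _ => 1 <= j
      | ICopy j k => wfi j /\ wfi k
      | ISet1 j => wfi j
      | IIncr j => wfi j
      | IOracle j => ok = true /\ 1 <= j
      | _ => False
      end
  | LSeq c1 c2 => lwf ok K c1 /\ lwf ok K c2
  | LIf t c1 c2 => wft t /\ lwf ok K c1 /\ lwf ok K c2
  | LUntil t c => wft t /\ lwf ok K c
  end.

Lemma code_length c b : length (code c b) = csize c.
Proof.
  revert b; induction c; intros b; simpl; rewrite ?length_app; simpl;
    rewrite ?length_app; simpl; auto.
  - rewrite IHc1, IHc2. simpl. lia.
  - rewrite IHc. simpl. lia.
Qed.

Definition code_at (P : list (instr A)) (b : nat) (L : list (instr A)) : Prop :=
  forall k ins, nth_error L k = Some ins -> nth_error P (b - 1 + k) = Some ins.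

Lemma code_at_app P b L1 L2 : 1 <= b ->
  code_at P b (L1 ++ L2) -> code_at P b L1 /\ code_at P (b + length L1) L2.
Proof.
  intros Hb H. split; intros k ins Hk.
  - apply H. rewrite nth_error_app1; [easy|]. apply nth_error_Some. congruence.
  - replace (b + length L1 - 1 + k) with (b - 1 + (length L1 + k)) by lia. apply H.
    rewrite nth_error_app2 by lia. now replace (length L1 + k - length L1) with k by lia.
Qed.

Lemma code_at_cons P b i L : 1 <= b ->
  code_at P b (i :: L) -> nth_error P (b - 1) = Some i /\ code_at P (b + 1) L.
Proof.
  intros Hb H. split.
  - specialize (H 0 i eq_refl). now rewrite Nat.add_0_r in H.
  - intros k ins Hk. replace (b + 1 - 1 + k) with (b - 1 + S k) by lia. now apply H.
Qed.

Lemma exec_inv O ins c c' : exec O ins c c' ->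
  match ins with
  | IRel i args l1 l2 =>
      rval A i (fun t => zreg c (args t)) /\ c' = mk l1 (st c) \/
      ~ rval A i (fun t => zreg c (args t)) /\ c' = mk l2 (st c)
  | IIdxEq j k l1 l2 =>
      ireg c j = ireg c k /\ c' = mk l1 (st c) \/
      ireg c j <> ireg c k /\ c' = mk l2 (st c)
  | IStop => False
  | a => exists s', atom_den O a (st c) s' /\ c' = mk (S (lab c)) s'
  end.
Proof.
  intros H; destruct H; try (left; now split); try (right; now split);
    eexists; (split; [cbn; try reflexivity|]); try reflexivity.
  - exists y. split; [eassumption|reflexivity].
  - reflexivity.
Qed.

Lemma exec_atom O a c s' : atom_den O a (st c) s' -> exec O a c (mk (S (lab c)) s').
Proof.
  destruct a; simpl; intros H; try contradiction; try (subst s'; constructor).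
  destruct H as (y & HO & ->). now constructor.
Qed.

Lemma exec_branch O t l1 l2 l s c' :
  exec O (branch t l1 l2) (mk l s) c' <->
  (holds t s /\ c' = mk l1 s \/ ~ holds t s /\ c' = mk l2 s).
Proof.
  split.
  - intros H. apply exec_inv in H. destruct t, s; simpl in *; exact H.
  - destruct t as [j k|i args]; intros [[H ->]|[H ->]]; simpl in *.
    + now apply (ExIdxT A O j k l1 l2 (mk l s)).
    + now apply (ExIdxF A O j k l1 l2 (mk l s)).
    + now apply (ExRelT A O i args l1 l2 (mk l s)).
    + now apply (ExRelF A O i args l1 l2 (mk l s)).
Qed.

Lemma exec_goto O l b s c' : exec O (goto b) (mk l s) c' <-> c' = mk b s.
Proof.
  change (goto b) with (branch (TEq 1 1) b b). rewrite exec_branch. simpl.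
  split; [tauto|now left].
Qed.

Lemma step_at O M b ins s c' : 1 <= b -> nth_error (prog M) (b - 1) = Some ins ->
  (step O M (mk b s) c' <-> exec O ins (mk b s) c').
Proof.
  intros Hb Hn. unfold step; simpl. split.
  - intros (_ & i & Hi & H). congruence.
  - intros H. split; [easy|]. now exists ins.
Qed.

Lemma lwf_atomic ok K a s l c' O : lwf ok K (LAtom a) ->
  exec O a (mk l s) c' -> exists s', atom_den O a s s' /\ c' = mk (S l) s'.
Proof.
  intros Hw H. apply exec_inv in H. destruct a, s; simpl in *; try contradiction; exact H.
Qed.

Lemma code_complete O M ok K c : forall b s s', lwf ok K c -> 1 <= b ->
  code_at (prog M) b (code c b) -> lden O c s s' ->
  reach O M (mk b s) (mk (b + csize c) s').
Proof.
  induction c as [|a|c1 IH1 c2 IH2|t c1 IH1 c2 IH2|t c IH]; intros b s s' Hw Hb Hc Hd;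
    simpl in Hc, Hd; cbn [csize].
  - subst. rewrite Nat.add_0_r. apply rt_refl.
  - apply code_at_cons in Hc as [Hn _]; [|easy]. rewrite Nat.add_1_r. apply rt_step.
    apply (step_at O M b a); auto. apply (exec_atom O a (mk b s)). now destruct s.
  - destruct Hd as (s1 & H1 & H2), Hw as [Hw1 Hw2].
    apply code_at_app in Hc as [Hc1 Hc2]; [|easy]. rewrite code_length in Hc2.
    apply rt_trans with (mk (b + csize c1) s1); [now apply IH1|].
    rewrite Nat.add_assoc. apply IH2; auto. lia.
  - destruct Hw as (_ & Hw1 & Hw2).
    apply code_at_cons in Hc as [Hn Hc]; [|easy].
    apply code_at_app in Hc as [Hc1 Hc2]; [|lia]. rewrite code_length in Hc2.
    apply code_at_cons in Hc2 as [Hg Hc2]; [|lia].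
    replace (b + (csize c1 + csize c2 + 2)) with (b + csize c1 + csize c2 + 2) by lia.
    destruct Hd as [[Ht Hd]|[Ht Hd]].
    + apply rt_trans with (mk (b + 1) s).
      { apply rt_step, (step_at _ _ _ _ _ _ Hb Hn), exec_branch. auto. }
      apply rt_trans with (mk (b + 1 + csize c1) s'); [apply IH1; auto; lia|].
      apply rt_step, (fun H => step_at _ _ _ _ _ _ H Hg); [lia|]. now apply exec_goto.
    + apply rt_trans with (mk (b + csize c1 + 2) s).
      { apply rt_step, (step_at _ _ _ _ _ _ Hb Hn), exec_branch. auto. }
      replace (b + csize c1 + csize c2 + 2) with (b + csize c1 + 2 + csize c2) by lia.
      apply IH2; auto; [lia|]. now replace (b + csize c1 + 2) with (b + 1 + csize c1 + 1) at 1 by lia.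
  - destruct Hw as (_ & Hw).
    apply code_at_cons in Hc as [Hn Hc]; [|easy].
    apply code_at_app in Hc as [Hc Hg]; [|lia]. rewrite code_length in Hg.
    apply code_at_cons in Hg as [Hg _]; [|lia].
    destruct Hd as [Hd Ht]. induction Hd as [s|s s1 s' [Hn1 H1] _ IHd].
    + apply rt_step, (step_at _ _ _ _ _ _ Hb Hn), exec_branch. left. split; auto.
      f_equal. lia.
    + apply rt_trans with (mk (b + 1) s).
      { apply rt_step, (step_at _ _ _ _ _ _ Hb Hn), exec_branch. auto. }
      apply rt_trans with (mk (b + 1 + csize c) s1); [apply IH; auto; lia|].
      apply rt_trans with (mk b s1); [|now apply IHd].
      apply rt_step, (fun H => step_at _ _ _ _ _ _ H Hg); [lia|]. now apply exec_goto.
Qed.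

(** A halting run ends on the stop label, which the block does not contain, so it has to leave the
    block through its exit label. The bound [n' <= n] allows the loop case to recurse on the
    remaining run. *)
Lemma code_sound O M ok K c : forall n b s cf, lwf ok K c -> 1 <= b ->
  code_at (prog M) b (code c b) -> b + csize c <= length (prog M) ->
  lab cf = length (prog M) -> nsteps O M n (mk b s) cf ->
  exists s' n', n' <= n /\ lden O c s s' /\ nsteps O M n' (mk (b + csize c) s') cf.
Proof.
  induction c as [|a|c1 IH1 c2 IH2|t c1 IH1 c2 IH2|t c IH];
    intros n b s cf Hw Hb Hc Hl Hf Hr; simpl in Hc; cbn [csize] in *.
  - exists s, n. rewrite Nat.add_0_r. repeat split; auto.
  - apply code_at_cons in Hc as [Hn _]; [|easy].
    destruct n as [|n]; simpl in Hr; [subst cf; simpl in Hf; lia|].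
    destruct Hr as (c1 & Hs & Hr). apply (step_at _ _ _ _ _ _ Hb Hn) in Hs.
    destruct (lwf_atomic _ _ _ _ _ _ _ Hw Hs) as (s' & Hd & ->).
    exists s', n. rewrite Nat.add_1_r. repeat split; auto.
  - destruct Hw as [Hw1 Hw2].
    apply code_at_app in Hc as [Hc1 Hc2]; [|easy]. rewrite code_length in Hc2.
    apply IH1 in Hr as (s1 & n1 & Hn1 & Hd1 & Hr); auto; [|lia].
    apply IH2 in Hr as (s2 & n2 & Hn2 & Hd2 & Hr); auto; try lia.
    exists s2, n2. rewrite Nat.add_assoc. repeat split; [lia| |auto].
    now exists s1.
  - destruct Hw as (_ & Hw1 & Hw2).
    apply code_at_cons in Hc as [Hn Hc]; [|easy].
    apply code_at_app in Hc as [Hc1 Hc2]; [|lia]. rewrite code_length in Hc2.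
    apply code_at_cons in Hc2 as [Hg Hc2]; [|lia].
    destruct n as [|n]; simpl in Hr; [subst cf; simpl in Hf; lia|].
    destruct Hr as (c' & Hs & Hr). apply (step_at _ _ _ _ _ _ Hb Hn), exec_branch in Hs.
    destruct Hs as [[Ht ->]|[Ht ->]].
    + apply IH1 in Hr as (s1 & n1 & Hn1 & Hd1 & Hr); auto; try lia.
      destruct n1 as [|n1]; simpl in Hr; [subst cf; simpl in Hf; lia|].
      destruct Hr as (c' & Hs & Hr).
      apply (fun H => step_at _ _ _ _ _ _ H Hg) in Hs; [|lia].
      apply exec_goto in Hs as ->. exists s1, n1. repeat split; [lia|simpl; auto|].
      now replace (b + (csize c1 + csize c2 + 2)) with (b + csize c1 + csize c2 + 2) by lia.
    + replace (b + 1 + csize c1 + 1) with (b + csize c1 + 2) in Hc2 by lia.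
      apply IH2 in Hr as (s1 & n1 & Hn1 & Hd1 & Hr); auto; try lia.
      exists s1, n1. repeat split; [lia|simpl; auto|].
      now replace (b + (csize c1 + csize c2 + 2)) with (b + csize c1 + 2 + csize c2) by lia.
  - destruct Hw as (_ & Hw).
    apply code_at_cons in Hc as [Hn Hc]; [|easy].
    apply code_at_app in Hc as [Hc Hg]; [|lia]. rewrite code_length in Hg.
    apply code_at_cons in Hg as [Hg _]; [|lia].
    (* Every further pass spends the branch and the jump back, so the remaining run gets strictly
       shorter. *)
    revert s Hr. induction n as [n IHn] using lt_wf_ind. intros s Hr.
    destruct n as [|n]; simpl in Hr; [subst cf; simpl in Hf; lia|].
    destruct Hr as (c' & Hs & Hr). apply (step_at _ _ _ _ _ _ Hb Hn), exec_branch in Hs.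
    destruct Hs as [[Ht ->]|[Ht ->]].
    + exists s, n. split; [lia|]. split; [split; [constructor|auto]|].
      now replace (b + (csize c + 2)) with (b + csize c + 2) by lia.
    + apply IH in Hr as (s1 & n1 & Hn1 & Hd1 & Hr); auto; try lia.
      destruct n1 as [|n1]; simpl in Hr; [subst cf; simpl in Hf; lia|].
      destruct Hr as (c' & Hs & Hr).
      apply (fun H => step_at _ _ _ _ _ _ H Hg) in Hs; [|lia].
      apply exec_goto in Hs as ->.
      apply IHn in Hr as (s2 & n2 & Hn2 & [Hd2 Ht2] & Hr); [|lia].
      exists s2, n2. split; [lia|]. split; [|easy]. split; [|easy].
      econstructor; [split; eauto|easy].
Qed.

Definition assemble (K : nat) (c : lcmd) : machine A :=
  {| nidx := K; prog := code c 1 ++ [IStop] |}.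

Lemma assemble_correct O K ok c s s' : lwf ok K c ->
  let M := assemble K c in
  (exists cf, reach O M (mk 1 s) cf /\ lab cf = length (prog M) /\ st cf = s') <->
  lden O c s s'.
Proof.
  intros Hw M.
  assert (Hl : length (prog M) = 1 + csize c).
  { simpl. rewrite length_app, code_length. simpl. lia. }
  assert (Hc : code_at (prog M) 1 (code c 1)).
  { intros k ins Hk. simpl. rewrite nth_error_app1; [easy|].
    apply nth_error_Some. congruence. }
  split.
  - intros (cf & Hr & Hf & Hs). apply reach_nsteps in Hr as [n Hr].
    apply (code_sound O M ok K c) in Hr as (s1 & n1 & _ & Hd & Hr); auto; [|lia].
    (* The run has arrived at the stop instruction, which has no successor. *)
    destruct n1 as [|n1]; simpl in Hr; [subst; now destruct s1|].
    destruct Hr as (c1 & (_ & ins & Hn & He) & _). simpl in Hn.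
    rewrite nth_error_app2 in Hn by (rewrite code_length; lia).
    rewrite code_length in Hn. replace (csize c - 0 - csize c) with 0 in Hn by lia.
    injection Hn as <-. now apply exec_inv in He.
  - intros Hd. exists (mk (1 + csize c) s'). split; [|split].
    + now apply (code_complete O M ok K).
    + now simpl in Hl |- *.
    + now destruct s'.
Qed.

Lemma code_wf ok K M c : forall b ins, nidx M = K -> 1 <= K -> lwf ok K c -> 1 <= b ->
  b + csize c <= length (prog M) -> In ins (code c b) -> wf_instr A ok M ins /\ ~ is_stop A ins.
Proof.
  intros b ins HK HK1. revert b.
  assert (Hbr : forall t l1 l2, match t with
    | TEq j k => 1 <= j <= K /\ 1 <= k <= K | TRel i args => forall t, 1 <= args t end ->
    1 <= l1 <= length (prog M) -> 1 <= l2 <= length (prog M) ->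
    wf_instr A ok M (branch t l1 l2) /\ ~ is_stop A (branch t l1 l2)).
  { intros [j k|i args] l1 l2; simpl; unfold wf_ireg, wf_zreg, wf_lab; rewrite ?HK; tauto. }
  assert (Hgo : forall l, 1 <= l <= length (prog M) ->
    wf_instr A ok M (goto l) /\ ~ is_stop A (goto l)).
  { intros l Hl; simpl; unfold wf_ireg, wf_lab; rewrite HK. repeat split; try lia; tauto. }
  induction c as [|a|c1 IH1 c2 IH2|t c1 IH1 c2 IH2|t c IH]; intros b Hw Hb Hl Hi;
    cbn [csize] in Hl; simpl in Hi.
  - contradiction.
  - destruct Hi as [<-|[]]. destruct a; simpl in *; unfold wf_ireg, wf_zreg;
      rewrite ?HK; tauto.
  - apply in_app_or in Hi. destruct Hw as [Hw1 Hw2], Hi as [Hi|Hi].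
    + apply (IH1 b); auto. lia.
    + apply (IH2 (b + csize c1)); auto; lia.
  - destruct Hw as (Ht & Hw1 & Hw2). destruct Hi as [<-|Hi]; [apply Hbr; auto; lia|].
    apply in_app_or in Hi. destruct Hi as [Hi|[<-|Hi]].
    + apply (IH1 (b + 1)); auto; lia.
    + apply Hgo; lia.
    + apply (IH2 (b + csize c1 + 2)); auto; lia.
  - destruct Hw as (Ht & Hw). destruct Hi as [<-|Hi]; [apply Hbr; auto; lia|].
    apply in_app_or in Hi. destruct Hi as [Hi|[<-|[]]].
    + apply (IH (b + 1)); auto; lia.
    + apply Hgo; lia.
Qed.

Lemma assemble_wf ok K c : 1 <= K -> lwf ok K c -> wf_machine A ok (assemble K c).
Proof.
  intros HK Hw.
  assert (Hc : forall ins, In ins (code c 1) ->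
    wf_instr A ok (assemble K c) ins /\ ~ is_stop A ins).
  { intros ins. apply (code_wf ok K); auto. simpl. rewrite length_app, code_length. simpl. lia. }
  split; [easy|]. split.
  - exists (code c 1). split; [easy|]. intros ins Hi. now apply Hc.
  - intros ins Hi. apply in_app_or in Hi as [Hi|[<-|[]]]; [now apply Hc|exact I].
Qed.
(** * Index expressions *)

Fixpoint oracle_free (c : lcmd) : Prop :=
  match c with
  | LAtom (IOracle _) => False
  | LSkip | LAtom _ => True
  | LSeq c1 c2 | LIf _ c1 c2 => oracle_free c1 /\ oracle_free c2
  | LUntil _ c => oracle_free c
  end.

(** Both runs end at the first state satisfying [T], so neither is a proper prefix of the other. *)
Lemma loop_deterministic {X : Type} (R : X -> X -> Prop) (T : X -> Prop) x y z :
  (forall a b c, ~ T a -> R a b -> R a c -> b = c) ->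
  clos_refl_trans_1n X (fun a b => ~ T a /\ R a b) x y -> T y ->
  clos_refl_trans_1n X (fun a b => ~ T a /\ R a b) x z -> T z -> y = z.
Proof.
  intros HR Hy HTy Hz HTz. induction Hy as [x|x w y [Hn Hw] _ IH].
  - destruct Hz as [|w z [Hn _] _]; [easy|contradiction].
  - destruct Hz as [|w' z [_ Hw'] Hz]; [contradiction|].
    apply IH; auto. now rewrite (HR x w w').
Qed.

Lemma lden_deterministic O c : oracle_free c ->
  forall s s1 s2, lden O c s s1 -> lden O c s s2 -> s1 = s2.
Proof.
  induction c as [|a|c1 IH1 c2 IH2|t c1 IH1 c2 IH2|t c IH]; simpl; intros Hf s s1 s2 H1 H2.
  - congruence.
  - destruct a; simpl in *; try contradiction; congruence.
  - destruct H1 as (u & Hu & H1), H2 as (v & Hv & H2).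
    rewrite (IH1 (proj1 Hf) _ _ _ Hu Hv) in H1. now apply (IH2 (proj2 Hf) v).
  - destruct H1 as [[T1 H1]|[T1 H1]], H2 as [[T2 H2]|[T2 H2]]; try contradiction;
      [eapply IH1|eapply IH2]; eauto; tauto.
  - destruct H1 as [H1 T1], H2 as [H2 T2].
    eapply loop_deterministic; [|exact H1|exact T1|exact H2|exact T2].
    intros a b d _. now apply IH.
Qed.

(** For deterministic commands, the existence of an outcome satisfying [P] is total correctness. *)
Definition lwp (O : list U -> U -> Prop) (c : lcmd) (s : state) (P : state -> Prop) : Prop :=
  exists s', lden O c s s' /\ P s'.

Lemma lwp_seq O c1 c2 s P : lwp O c1 s (fun s1 => lwp O c2 s1 P) -> lwp O (LSeq c1 c2) s P.
Proof. intros (s1 & H1 & s2 & H2 & HP). exists s2. split; [now exists s1|easy]. Qed.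

Lemma lwp_set1 O j s (P : state -> Prop) :
  P (upd (fst s) j 1, snd s) -> lwp O (LAtom (ISet1 j)) s P.
Proof. intros HP. eexists; split; [reflexivity|easy]. Qed.

Lemma lwp_incr O j s (P : state -> Prop) :
  P (upd (fst s) j (S (fst s j)), snd s) -> lwp O (LAtom (IIncr j)) s P.
Proof. intros HP. eexists; split; [reflexivity|easy]. Qed.

(** The index of the invariant is the variant that makes the loop terminate. *)
Lemma lwp_until O t c (I : nat -> state -> Prop) (P : state -> Prop) :
  (forall n s, I n s -> holds t s /\ P s \/
     ~ holds t s /\ lwp O c s (fun s' => exists n', n' < n /\ I n' s')) ->
  forall n s, I n s -> lwp O (LUntil t c) s P.
Proof.
  intros H n. induction n as [n IH] using lt_wf_ind. intros s Hs.
  destruct (H n s Hs) as [[Ht HP]|[Ht (s1 & Hd & n' & Hn & H1)]].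
  - exists s. split; [split; [constructor|easy]|easy].
  - destruct (IH n' Hn s1 H1) as (s2 & [Hd2 Ht2] & HP). exists s2. split; [|easy].
    split; [|easy]. econstructor; eauto.
Qed.

Inductive expr : Type :=
| EC (n : nat)
| ER (r : nat)
| EAdd (a b : expr)
| EMul (a b : expr).

Fixpoint eval (e : expr) (i : nat -> nat) : nat :=
  match e with
  | EC n => n
  | ER r => i r
  | EAdd a b => eval a i + eval b i
  | EMul a b => eval a i * eval b i
  end.

(** Constants are positive because a register is set to 1 and then incremented; the registers from
    [tau] on are kept free for scratch work. *)
Fixpoint ewf (tau : nat) (e : expr) : Prop :=
  match e with
  | EC n => 1 <= n
  | ER r => 1 <= r < tau
  | EAdd a b | EMul a b => ewf tau a /\ ewf tau b
  end.

Definition lincrs (j n : nat) : lcmd := Nat.iter n (LSeq (LAtom (IIncr j))) LSkip.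

Definition lcopy (j k : nat) : lcmd :=
  LSeq (LAtom (ISet1 j)) (LUntil (TEq j k) (LAtom (IIncr j))).

(** The counter [c] runs from 1, not 0, to the value of [b]; the first increment of [j] makes up for
    the missing pass. *)
Definition ladd (j b c : nat) : lcmd :=
  LSeq (LAtom (ISet1 c)) (LSeq (LAtom (IIncr j))
    (LUntil (TEq c b) (LSeq (LAtom (IIncr c)) (LAtom (IIncr j))))).

(** Registers from [j] on form a stack: the value ends in [j], and nothing below [j] is written. For
    a product, [j] starts with the first factor and receives it once more for every further unit of
    the second. *)
Fixpoint cexpr (e : expr) (j : nat) : lcmd :=
  match e with
  | EC n => LSeq (LAtom (ISet1 j)) (lincrs j (n - 1))
  | ER r => lcopy j r
  | EAdd a b => LSeq (cexpr a j) (LSeq (cexpr b (j + 1)) (ladd j (j + 1) (j + 2)))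
  | EMul a b =>
      LSeq (cexpr a (j + 1)) (LSeq (cexpr b (j + 2)) (LSeq (lcopy j (j + 1))
        (LSeq (LAtom (ISet1 (j + 3))) (LUntil (TEq (j + 3) (j + 2))
          (LSeq (LAtom (IIncr (j + 3))) (ladd j (j + 1) (j + 4)))))))
  end.

Lemma eval_pos tau e i : ewf tau e -> (forall r, 1 <= r < tau -> 1 <= i r) -> 1 <= eval e i.
Proof.
  induction e; simpl; intros Hw Hi; auto; destruct Hw.
  - specialize (IHe1 H Hi). lia.
  - specialize (IHe1 H Hi). specialize (IHe2 H0 Hi). nia.
Qed.

Lemma eval_ext tau e i i' : ewf tau e -> (forall r, 1 <= r < tau -> i' r = i r) ->
  eval e i' = eval e i.
Proof.
  induction e; simpl; intros Hw Hi; auto; destruct Hw; rewrite IHe1, IHe2; auto.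
Qed.

Lemma lwp_lincrs O j n s (P : state -> Prop) :
  (forall i', i' j = fst s j + n -> (forall r, r <> j -> i' r = fst s r) -> P (i', snd s)) ->
  lwp O (lincrs j n) s P.
Proof.
  revert s. induction n as [|n IH]; intros s HP.
  - exists s. split; [reflexivity|]. destruct s. apply HP; simpl; auto.
  - apply lwp_seq, lwp_incr, IH. intros i' Hj Hr. apply HP.
    + rewrite Hj. simpl. upds. lia.
    + intros r Hne. rewrite Hr by easy. simpl. now upds.
Qed.

Lemma lwp_lcopy O j k s (P : state -> Prop) : j <> k -> 1 <= fst s k ->
  (forall i', i' j = fst s k -> (forall r, r <> j -> i' r = fst s r) -> P (i', snd s)) ->
  lwp O (lcopy j k) s P.
Proof.
  intros Hjk Hk HP. apply lwp_seq, lwp_set1.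
  apply lwp_until with (n := fst s k - 1) (I := fun n s' =>
    fst s' j + n = fst s k /\ snd s' = snd s /\ forall r, r <> j -> fst s' r = fst s r).
  - intros n [i z] (Hn & Hz & Hr). simpl in *. subst z. rewrite (Hr k) by lia.
    destruct (Nat.eq_dec (i j) (fst s k)) as [E|E]; [left; auto|right; split; [easy|]].
    apply lwp_incr. exists (n - 1). simpl. split; [lia|]. split; [upds; lia|].
    split; [easy|]. intros r Hrj. upds. auto.
  - simpl. split; [upds; lia|]. split; [easy|]. intros r Hrj. now upds.
Qed.

Lemma lwp_ladd O j b c s (P : state -> Prop) : j <> b -> c <> b -> j <> c -> 1 <= fst s b ->
  (forall i', i' j = fst s j + fst s b -> (forall r, r <> j -> r <> c -> i' r = fst s r) ->
     P (i', snd s)) ->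
  lwp O (ladd j b c) s P.
Proof.
  intros Hjb Hcb Hjc Hb HP. apply lwp_seq, lwp_set1, lwp_seq, lwp_incr.
  apply lwp_until with (n := fst s b - 1) (I := fun n s' =>
    fst s' j + n = fst s j + fst s b /\ fst s' c + n = fst s b /\ snd s' = snd s /\
    forall r, r <> j -> r <> c -> fst s' r = fst s r).
  - intros n [i z] (Hj & Hc & Hz & Hr). simpl in *. subst z. rewrite (Hr b) by lia.
    destruct (Nat.eq_dec (i c) (fst s b)) as [E|E].
    { left. split; [easy|]. apply HP; auto. lia. }
    right; split; [easy|].
    apply lwp_seq, lwp_incr, lwp_incr. exists (n - 1). simpl. split; [lia|].
    split; [upds; lia|]. split; [upds; lia|].
    split; [easy|]. intros r Hrj Hrc. upds. auto.
  - simpl. split; [upds; lia|]. split; [upds; lia|]. split; [easy|].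
    intros r Hrj Hrc. now upds.
Qed.

Lemma lwp_cexpr O tau e : forall j s (P : state -> Prop), ewf tau e -> tau <= j ->
  (forall r, 1 <= r < tau -> 1 <= fst s r) ->
  (forall i', i' j = eval e (fst s) -> (forall r, r < j -> i' r = fst s r) -> P (i', snd s)) ->
  lwp O (cexpr e j) s P.
Proof.
  induction e as [n|r|a IHa b IHb|a IHa b IHb]; intros j s P Hw Htj Hs HP; simpl in Hw;
    cbn [cexpr].
  - apply lwp_seq, lwp_set1, lwp_lincrs. simpl. intros i' Hj Hr. apply HP.
    + rewrite Hj. upds. simpl. lia.
    + intros r Hrj. rewrite Hr by lia. now upds.
  - apply lwp_lcopy; [lia|auto|]. intros i' Hj Hr. apply HP; [easy|].
    intros q Hq. apply Hr. lia.
  - destruct Hw as [Ha Hb]. pose proof (eval_pos _ _ _ Ha Hs). pose proof (eval_pos _ _ _ Hb Hs).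
    apply lwp_seq, IHa; auto. intros i1 Hi1 Hr1.
    apply lwp_seq, IHb; simpl; [easy|lia|intros r Hr; rewrite Hr1 by lia; auto|].
    intros i2 Hi2 Hr2. rewrite (eval_ext tau b (fst s)) in Hi2 by (auto; intros; apply Hr1; lia).
    apply lwp_ladd; simpl; try lia. intros i3 Hi3 Hr3. apply HP.
    + simpl. rewrite Hi3, (Hr2 j) by lia. lia.
    + intros r Hr. rewrite Hr3, Hr2, Hr1; lia.
  - destruct Hw as [Ha Hb]. pose proof (eval_pos _ _ _ Ha Hs). pose proof (eval_pos _ _ _ Hb Hs).
    apply lwp_seq, IHa; auto; [lia|]. intros i1 Hi1 Hr1.
    apply lwp_seq, IHb; simpl; [easy|lia|intros r Hr; rewrite Hr1 by lia; auto|].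
    intros i2 Hi2 Hr2. rewrite (eval_ext tau b (fst s)) in Hi2 by (auto; intros; apply Hr1; lia).
    rewrite <- Hr2 in Hi1 by lia.
    apply lwp_seq, lwp_lcopy; simpl; [lia|lia|]. intros i3 Hi3 Hr3.
    apply lwp_seq, lwp_set1. simpl.
    apply lwp_until with (n := i2 (j + 2) - 1) (I := fun n s' =>
      fst s' j = i2 (j + 1) * fst s' (j + 3) /\ fst s' (j + 3) + n = i2 (j + 2) /\
      fst s' (j + 1) = i2 (j + 1) /\ fst s' (j + 2) = i2 (j + 2) /\
      snd s' = snd s /\ forall r, r < j -> fst s' r = fst s r).
    + intros n [i z] (Hj & Hc & H1 & H2 & Hz & Hr). simpl in *. subst z. rewrite H2.
      destruct (Nat.eq_dec (i (j + 3)) (i2 (j + 2))) as [E|E].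
      { left. split; [easy|]. apply HP; auto. simpl. congruence. }
      right; split; [easy|].
      apply lwp_seq, lwp_incr, lwp_ladd; simpl; try lia; [upds; lia|].
      upds. intros i4 Hi4 Hr4. exists (n - 1). split; [lia|].
      rewrite (Hr4 (j + 3)), (Hr4 (j + 1)), (Hr4 (j + 2)) by lia. upds. repeat split; try lia; try easy.
      intros r Hrj. rewrite Hr4 by lia. upds. auto.
    + simpl. upds. rewrite Hi3, !Hr3 by lia. repeat split; try lia; try easy.
      intros r Hrj. upds. rewrite Hr3, Hr2, Hr1; lia.
Qed.

Lemma cexpr_oracle_free e j : oracle_free (cexpr e j).
Proof.
  revert j. induction e; intros j; simpl; repeat split; auto.
  unfold lincrs. induction (n - 1); simpl; auto.
Qed.

(** Stated for all sufficiently large [K], so that the requirements of subexpressions can be added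
    up. *)
Lemma cexpr_lwf ok tau e : ewf tau e -> forall j, 1 <= j -> tau <= j ->
  exists K0, forall K, K0 <= K -> lwf ok K (cexpr e j).
Proof.
  induction e as [n|r|a IHa b IHb|a IHa b IHb]; intros Hw j Hj Ht; simpl in Hw.
  - exists j. intros K HK. simpl. split; [lia|]. unfold lincrs.
    induction (n - 1); simpl; auto.
  - exists j. intros K HK. simpl. lia.
  - destruct Hw as [Ha Hb]. destruct (IHa Ha j Hj Ht) as [K1 H1].
    destruct (IHb Hb (j + 1)) as [K2 H2]; [lia|lia|].
    exists (K1 + K2 + j + 2). intros K HK. simpl.
    split; [apply H1; lia|]. split; [apply H2; lia|]. lia.
  - destruct Hw as [Ha Hb]. destruct (IHa Ha (j + 1)) as [K1 H1]; [lia|lia|].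
    destruct (IHb Hb (j + 2)) as [K2 H2]; [lia|lia|].
    exists (K1 + K2 + j + 4). intros K HK. simpl.
    split; [apply H1; lia|]. split; [apply H2; lia|]. lia.
Qed.

(** * The while language with computed addresses *)

Inductive cmd : Type :=
| Skip
| Asg (r : nat) (e : expr)
| ZCopy (e1 e2 : expr)
| ZFun (j : nat) (i : fidx A) (args : Fin.t (farity A i) -> nat)
| ZConst (j : nat) (i : cidx A)
| ZOracle (j : nat)
| Seq (c1 c2 : cmd)
| IfEq (e1 e2 : expr) (c1 c2 : cmd)
| IfRel (i : ridx A) (args : Fin.t (rarity A i) -> nat) (c1 c2 : cmd)
| While (e1 e2 : expr) (c : cmd).

Definition evals_eq (e1 e2 : expr) (s : state) : Prop := eval e1 (fst s) = eval e2 (fst s).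

Fixpoint den (O : list U -> U -> Prop) (c : cmd) (s s' : state) : Prop :=
  match c with
  | Skip => s' = s
  | Asg r e => s' = (upd (fst s) r (eval e (fst s)), snd s)
  | ZCopy e1 e2 => s' = (fst s, upd (snd s) (eval e1 (fst s)) (snd s (eval e2 (fst s))))
  | ZFun j i args => s' = (fst s, upd (snd s) j (fval A i (fun t => snd s (args t))))
  | ZConst j i => s' = (fst s, upd (snd s) j (cval A i))
  | ZOracle j => exists y, O (out (mk 0 s)) y /\ s' = (fst s, upd (snd s) j y)
  | Seq c1 c2 => exists s1, den O c1 s s1 /\ den O c2 s1 s'
  | IfEq e1 e2 c1 c2 =>
      evals_eq e1 e2 s /\ den O c1 s s' \/ ~ evals_eq e1 e2 s /\ den O c2 s s'
  | IfRel i args c1 c2 =>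
      rval A i (fun t => snd s (args t)) /\ den O c1 s s' \/
      ~ rval A i (fun t => snd s (args t)) /\ den O c2 s s'
  | While e1 e2 c =>
      clos_refl_trans_1n state (fun a b => ~ evals_eq e1 e2 a /\ den O c a b) s s' /\
      evals_eq e1 e2 s'
  end.

Fixpoint wf (ok : bool) (tau : nat) (c : cmd) : Prop :=
  match c with
  | Skip => True
  | Asg r e => 1 <= r < tau /\ ewf tau e
  | ZCopy e1 e2 => ewf tau e1 /\ ewf tau e2
  | ZFun j i args => 1 <= j /\ forall t, 1 <= args t
  | ZConst j i => 1 <= j
  | ZOracle j => ok = true /\ 1 <= j
  | Seq c1 c2 => wf ok tau c1 /\ wf ok tau c2
  | IfEq e1 e2 c1 c2 => ewf tau e1 /\ ewf tau e2 /\ wf ok tau c1 /\ wf ok tau c2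
  | IfRel i args c1 c2 => (forall t, 1 <= args t) /\ wf ok tau c1 /\ wf ok tau c2
  | While e1 e2 c => ewf tau e1 /\ ewf tau e2 /\ wf ok tau c
  end.

Section Translation.
Context (tau : nat).

Definition eval2 (e1 e2 : expr) : lcmd := LSeq (cexpr e1 tau) (cexpr e2 (tau + 1)).

(** A low-level loop compares two registers, so the operands of [While] are evaluated before the
    loop and again at the end of each pass. *)
Fixpoint tr (c : cmd) : lcmd :=
  match c with
  | Skip => LSkip
  | Asg r e => LSeq (cexpr e tau) (lcopy r tau)
  | ZCopy e1 e2 => LSeq (eval2 e1 e2) (LAtom (ICopy tau (tau + 1)))
  | ZFun j i args => LAtom (IFun j i args)
  | ZConst j i => LAtom (IConst j i)
  | ZOracle j => LAtom (IOracle j)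
  | Seq c1 c2 => LSeq (tr c1) (tr c2)
  | IfEq e1 e2 c1 c2 => LSeq (eval2 e1 e2) (LIf (TEq tau (tau + 1)) (tr c1) (tr c2))
  | IfRel i args c1 c2 => LIf (TRel i args) (tr c1) (tr c2)
  | While e1 e2 c =>
      LSeq (eval2 e1 e2) (LUntil (TEq tau (tau + 1)) (LSeq (tr c) (eval2 e1 e2)))
  end.

(* The registers from [tau] on are scratch space for the evaluation of expressions. *)
Definition same (s t : state) : Prop :=
  (forall r, 1 <= r < tau -> fst t r = fst s r /\ 1 <= fst s r) /\ snd t = snd s.

Lemma eval2_total O e1 e2 s t : 1 <= tau -> ewf tau e1 -> ewf tau e2 -> same s t ->
  exists t', lden O (eval2 e1 e2) t t' /\ same s t' /\
    fst t' tau = eval e1 (fst s) /\ fst t' (tau + 1) = eval e2 (fst s).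
Proof.
  intros Htau H1 H2 [Hr Hz].
  apply lwp_seq. apply lwp_cexpr with tau; auto.
  { intros r Hr1. rewrite (proj1 (Hr r Hr1)). now apply Hr. }
  intros i1 Hi1 Hr1. apply lwp_cexpr with tau; simpl; auto; [lia| |].
  { intros r Hr2. rewrite Hr1 by lia. rewrite (proj1 (Hr r Hr2)). now apply Hr. }
  intros i2 Hi2 Hr2. split; [split|split]; simpl; auto.
  - intros r Hr3. rewrite Hr2, Hr1 by lia. now apply Hr.
  - rewrite Hr2 by lia. rewrite Hi1. apply eval_ext with tau; [easy|].
    intros r Hr3. now apply Hr.
  - rewrite Hi2. apply eval_ext with tau; [easy|].
    intros r Hr3. rewrite Hr1 by lia. now apply Hr.
Qed.

(** By determinism the outcome exhibited by [eval2_total] is the only one. *)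
Lemma eval2_inv O e1 e2 s t t' : 1 <= tau -> ewf tau e1 -> ewf tau e2 -> same s t ->
  lden O (eval2 e1 e2) t t' -> same s t' /\
    fst t' tau = eval e1 (fst s) /\ fst t' (tau + 1) = eval e2 (fst s).
Proof.
  intros Htau H1 H2 Hs Hd. destruct (eval2_total O e1 e2 s t) as (t1 & Hd1 & H); auto.
  rewrite (lden_deterministic O (eval2 e1 e2)) with (s := t) (s1 := t') (s2 := t1); auto.
  split; apply cexpr_oracle_free.
Qed.

Lemma asg_total O r e s t : 1 <= tau -> 1 <= r < tau -> ewf tau e -> same s t ->
  exists t', lden O (tr (Asg r e)) t t' /\
    same (upd (fst s) r (eval e (fst s)), snd s) t'.
Proof.
  intros Htau Hr1 He [Hr Hz].
  assert (Hpos : forall r, 1 <= r < tau -> 1 <= fst s r) by (intros q Hq; now apply Hr).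
  assert (He' : eval e (fst t) = eval e (fst s)).
  { apply eval_ext with tau; [easy|]. intros q Hq. now apply Hr. }
  pose proof (eval_pos tau e (fst s) He Hpos).
  apply lwp_seq, lwp_cexpr with tau; auto.
  { intros q Hq. rewrite (proj1 (Hr q Hq)). now apply Hr. }
  intros i1 Hi1 Hq1. apply lwp_lcopy; simpl; [lia|lia|].
  intros i2 Hi2 Hq2. split; simpl; [|easy]. intros q Hq.
  destruct (Nat.eq_dec q r) as [->|Hne]; upds.
  - lia.
  - rewrite Hq2, Hq1 by lia. now apply Hr.
Qed.

Lemma tr_complete O ok c : 2 <= tau -> wf ok tau c -> forall s s' t, same s t -> den O c s s' ->
  exists t', lden O (tr c) t t' /\ same s' t'.
Proof.
  intros Htau. induction c as [|r e|e1 e2|j i args|j i|j|c1 IH1 c2 IH2|e1 e2 c1 IH1 c2 IH2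
    |i args c1 IH1 c2 IH2|e1 e2 c IH]; intros Hw s s' t Hs Hd; simpl in Hw, Hd; cbn [tr].
  - subst. exists t. now split.
  - subst. apply asg_total; try tauto; lia.
  - subst. destruct (eval2_total O e1 e2 s t) as (t1 & Hd1 & [Hs1 Hz1] & E1 & E2); try tauto; [lia|].
    eexists. split; [exists t1; split; [exact Hd1|reflexivity]|].
    rewrite E1, E2, Hz1. now split.
  - subst. eexists. split; [reflexivity|]. destruct Hs as [Hr Hz]. rewrite Hz. now split.
  - subst. eexists. split; [reflexivity|]. destruct Hs as [Hr Hz]. rewrite Hz. now split.
  - destruct Hs as [Hr Hz], Hd as (y & HO & ->). eexists. split.
    (* [I_1] lies below [tau], so it delimits the same oracle query in both states. *)
    + exists y. split; [|reflexivity]. unfold out, mk in *. simpl in *.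
      rewrite Hz, (proj1 (Hr 1 ltac:(lia))). exact HO.
    + rewrite Hz. now split.
  - destruct Hd as (s1 & Hd1 & Hd2). destruct (IH1 (proj1 Hw) s s1 t) as (t1 & H1 & Hs1); auto.
    destruct (IH2 (proj2 Hw) s1 s' t1) as (t2 & H2 & Hs2); auto.
    exists t2. split; [now exists t1|easy].
  - destruct Hw as (He1 & He2 & Hw1 & Hw2).
    destruct (eval2_total O e1 e2 s t) as (t1 & Hd1 & Hs1 & E1 & E2); auto; [lia|].
    destruct Hd as [[Ht Hd]|[Ht Hd]].
    + destruct (IH1 Hw1 s s' t1) as (t2 & H2 & Hs2); auto. exists t2. split; [|easy].
      exists t1. split; [easy|]. left. split; [|easy]. unfold evals_eq in Ht. simpl. lia.
    + destruct (IH2 Hw2 s s' t1) as (t2 & H2 & Hs2); auto. exists t2. split; [|easy].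
      exists t1. split; [easy|]. right. split; [|easy]. unfold evals_eq in Ht. simpl. lia.
  - destruct Hw as (Hargs & Hw1 & Hw2). pose proof (proj2 Hs) as Hz.
    destruct Hd as [[Ht Hd]|[Ht Hd]].
    + destruct (IH1 Hw1 s s' t) as (t2 & H2 & Hs2); auto. exists t2. split; [|easy].
      left. simpl. now rewrite Hz.
    + destruct (IH2 Hw2 s s' t) as (t2 & H2 & Hs2); auto. exists t2. split; [|easy].
      right. simpl. now rewrite Hz.
  - destruct Hw as (He1 & He2 & Hw). destruct Hd as [Hd Ht].
    enough (Hloop : forall t1, same s t1 -> fst t1 tau = eval e1 (fst s) ->
      fst t1 (tau + 1) = eval e2 (fst s) -> exists t',
      lden O (LUntil (TEq tau (tau + 1)) (LSeq (tr c) (eval2 e1 e2))) t1 t' /\ same s' t').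
    { destruct (eval2_total O e1 e2 s t) as (t1 & Hd1 & Hs1 & E1 & E2); auto; [lia|].
      destruct (Hloop t1) as (t2 & H2 & Hs2); auto. exists t2. split; [now exists t1|easy]. }
    clear t Hs. unfold evals_eq in Ht.
    induction Hd as [s|s s1 s' [Hn H1] _ IHd]; intros t1 Hs E1 E2.
    + exists t1. split; [|easy]. split; [constructor|]. simpl. lia.
    + destruct (IH Hw s s1 t1) as (t2 & Hd2 & Hs2); auto.
      destruct (eval2_total O e1 e2 s1 t2) as (t3 & Hd3 & Hs3 & E31 & E32); auto; [lia|].
      destruct (IHd Ht t3) as (t4 & [Hd4 Ht4] & Hs4); auto.
      exists t4. split; [|easy]. split; [|easy]. econstructor; [|exact Hd4].
      unfold evals_eq in Hn. split; [simpl; lia|]. now exists t2.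
Qed.

Lemma tr_sound O ok c : 2 <= tau -> wf ok tau c -> forall s t t', same s t -> lden O (tr c) t t' ->
  exists s', den O c s s' /\ same s' t'.
Proof.
  intros Htau. induction c as [|r e|e1 e2|j i args|j i|j|c1 IH1 c2 IH2|e1 e2 c1 IH1 c2 IH2
    |i args c1 IH1 c2 IH2|e1 e2 c IH]; intros Hw s t t' Hs Hd; simpl in Hw; cbn [tr] in Hd.
  - simpl in Hd. subst. exists s. now split.
  - destruct (asg_total O r e s t) as (t1 & Hd1 & Hs1); try tauto; [lia|].
    eexists. split; [reflexivity|].
    rewrite (lden_deterministic O (tr (Asg r e))) with (s := t) (s1 := t') (s2 := t1); auto.
    simpl. pose proof (cexpr_oracle_free e tau). tauto.
  - destruct Hd as (t1 & Hd1 & Hd). simpl in Hd. subst t'.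
    destruct (eval2_inv O e1 e2 s t t1) as ([Hs1 Hz1] & E1 & E2); try tauto; [lia|].
    eexists. split; [reflexivity|]. rewrite E1, E2, Hz1. now split.
  - simpl in Hd. subst. eexists. split; [reflexivity|]. destruct Hs as [Hr Hz]. rewrite Hz. now split.
  - simpl in Hd. subst. eexists. split; [reflexivity|]. destruct Hs as [Hr Hz]. rewrite Hz. now split.
  - destruct Hs as [Hr Hz], Hd as (y & HO & ->). eexists. split.
    + exists y. split; [|reflexivity]. unfold out, mk in *. simpl in *.
      rewrite Hz, (proj1 (Hr 1 ltac:(lia))) in HO. exact HO.
    + rewrite Hz. now split.
  - destruct Hd as (t1 & Hd1 & Hd2). destruct (IH1 (proj1 Hw) s t t1) as (s1 & H1 & Hs1); auto.
    destruct (IH2 (proj2 Hw) s1 t1 t') as (s2 & H2 & Hs2); auto.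
    exists s2. split; [now exists s1|easy].
  - destruct Hw as (He1 & He2 & Hw1 & Hw2). destruct Hd as (t1 & Hd1 & Hd).
    destruct (eval2_inv O e1 e2 s t t1) as (Hs1 & E1 & E2); auto; [lia|].
    destruct Hd as [[Ht Hd]|[Ht Hd]]; simpl in Ht.
    + destruct (IH1 Hw1 s t1 t') as (s2 & H2 & Hs2); auto. exists s2. split; [|easy].
      left. split; [|easy]. unfold evals_eq. lia.
    + destruct (IH2 Hw2 s t1 t') as (s2 & H2 & Hs2); auto. exists s2. split; [|easy].
      right. split; [|easy]. unfold evals_eq. lia.
  - destruct Hw as (Hargs & Hw1 & Hw2). pose proof (proj2 Hs) as Hz.
    destruct Hd as [[Ht Hd]|[Ht Hd]]; simpl in Ht; rewrite Hz in Ht.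
    + destruct (IH1 Hw1 s t t') as (s2 & H2 & Hs2); auto. exists s2. split; [|easy].
      now left.
    + destruct (IH2 Hw2 s t t') as (s2 & H2 & Hs2); auto. exists s2. split; [|easy].
      now right.
  - destruct Hw as (He1 & He2 & Hw). destruct Hd as (t1 & Hd1 & Hd & Ht).
    destruct (eval2_inv O e1 e2 s t t1) as (Hs1 & E1 & E2); auto; [lia|].
    clear t Hs Hd1. revert s Hs1 E1 E2.
    induction Hd as [t|t1 t2 t' [Hn (t3 & H1 & H2)] _ IHd]; intros s Hs E1 E2; simpl in *.
    + exists s. split; [|easy]. split; [constructor|]. unfold evals_eq. lia.
    + destruct (IH Hw s t1 t3) as (s1 & Hd1 & Hs1); auto.
      destruct (eval2_inv O e1 e2 s1 t3 t2) as (Hs2 & E21 & E22); auto; [lia|].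
      destruct (IHd Ht s1) as (s2 & [Hd2 Ht2] & Hs3); auto.
      exists s2. split; [|easy]. split; [|easy]. econstructor; [|exact Hd2].
      split; [unfold evals_eq; lia|easy].
Qed.

Lemma tr_lwf ok c : 2 <= tau -> wf ok tau c ->
  exists K0, forall K, K0 <= K -> lwf ok K (tr c).
Proof.
  intros Htau.
  assert (E2 : forall e1 e2, ewf tau e1 -> ewf tau e2 ->
    exists K0, forall K, K0 <= K -> lwf ok K (eval2 e1 e2)).
  { intros e1 e2 H1 H2. destruct (cexpr_lwf ok tau e1 H1 tau) as [K1 HK1]; [lia|lia|].
    destruct (cexpr_lwf ok tau e2 H2 (tau + 1)) as [K2 HK2]; [lia|lia|].
    exists (K1 + K2). intros K HK. split; [apply HK1|apply HK2]; lia. }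
  induction c as [|r e|e1 e2|j i args|j i|j|c1 IH1 c2 IH2|e1 e2 c1 IH1 c2 IH2
    |i args c1 IH1 c2 IH2|e1 e2 c IH]; intros Hw; simpl in Hw; cbn [tr];
    try (exists 0; intros K HK; simpl; tauto).
  - destruct (cexpr_lwf ok tau e (proj2 Hw) tau) as [K1 HK1]; [lia|lia|].
    exists (K1 + tau). intros K HK. split; [apply HK1; lia|]. simpl. lia.
  - destruct (E2 e1 e2) as [K1 HK1]; try tauto. exists (K1 + tau + 1).
    intros K HK. split; [apply HK1; lia|]. simpl. lia.
  - destruct IH1 as [K1 HK1], IH2 as [K2 HK2]; try tauto. exists (K1 + K2).
    intros K HK. split; [apply HK1|apply HK2]; lia.
  - destruct IH1 as [K1 HK1], IH2 as [K2 HK2], (E2 e1 e2) as [K3 HK3]; try tauto.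
    exists (K1 + K2 + K3 + tau + 1). intros K HK.
    split; [apply HK3; lia|]. split; [lia|]. split; [apply HK1|apply HK2]; lia.
  - destruct IH1 as [K1 HK1], IH2 as [K2 HK2]; try tauto. exists (K1 + K2).
    intros K HK. split; [tauto|]. split; [apply HK1|apply HK2]; lia.
  - destruct IH as [K1 HK1], (E2 e1 e2) as [K3 HK3]; try tauto.
    exists (K1 + K3 + tau + 1). intros K HK.
    split; [apply HK3; lia|]. split; [lia|]. split; [apply HK1|apply HK3]; lia.
Qed.
End Translation.

(** The machine is chosen before the oracle and the start state. All index registers must start
    positive, since the evaluation loops count upwards from 1. *)
Lemma compile ok tau c : 2 <= tau -> wf ok tau c ->
  exists M, wf_machine A ok M /\ forall O s y, (forall r, 1 <= fst s r) ->
    ((exists cf, reach O M (mk 1 s) cf /\ lab cf = length (prog M) /\ y = out cf) <->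
     (exists s', den O c s s' /\ y = out (mk 0 s'))).
Proof.
  intros Htau Hw. destruct (tr_lwf tau ok c Htau Hw) as [K0 HK0].
  set (K := K0 + 1). assert (Hl : lwf ok K (tr tau c)) by (apply HK0; lia).
  exists (assemble K (tr tau c)). split; [apply assemble_wf; [lia|easy]|].
  assert (Hout : forall (s : state) (c : config A), same tau s (st c) -> out c = out (mk 0 s)).
  { intros s [l i z] [Hr Hz]. simpl in *. subst. unfold out. simpl.
    now rewrite (proj1 (Hr 1 ltac:(lia))). }
  intros O s y Hpos.
  assert (Hs : same tau s s) by (split; [|easy]; intros r _; now split).
  split.
  - intros (cf & Hr & Hf & ->).
    assert (Hd : lden O (tr tau c) s (st cf)).
    { apply (assemble_correct O K ok); [easy|]. now exists cf. }
    destruct (tr_sound tau O ok c Htau Hw s s (st cf) Hs Hd) as (s' & Hd' & Hs').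
    exists s'. split; [easy|]. now apply Hout.
  - intros (s' & Hd & ->).
    destruct (tr_complete tau O ok c Htau Hw s s' s Hs Hd) as (t' & Hd' & Hs').
    apply (assemble_correct O K ok) in Hd' as (cf & Hr & Hf & E); [|easy].
    exists cf. repeat split; auto. symmetry. apply Hout. now rewrite E.
Qed.

(** * Determinism and total correctness for the language with computed addresses *)

Fixpoint oracle_free_cmd (c : cmd) : Prop :=
  match c with
  | ZOracle _ => False
  | Seq c1 c2 | IfEq _ _ c1 c2 | IfRel _ _ c1 c2 => oracle_free_cmd c1 /\ oracle_free_cmd c2
  | While _ _ c => oracle_free_cmd c
  | _ => True
  end.

Lemma den_deterministic O c : oracle_free_cmd c ->
  forall s s1 s2, den O c s s1 -> den O c s s2 -> s1 = s2.
Proof.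
  induction c as [|r e|e1 e2|j i args|j i|j|c1 IH1 c2 IH2|e1 e2 c1 IH1 c2 IH2
    |i args c1 IH1 c2 IH2|e1 e2 c IH]; simpl; intros Hf s s1 s2 H1 H2;
    try contradiction; try congruence.
  - destruct H1 as (u & Hu & H1), H2 as (v & Hv & H2).
    rewrite (IH1 (proj1 Hf) _ _ _ Hu Hv) in H1. now apply (IH2 (proj2 Hf) v).
  - destruct H1 as [[T1 H1]|[T1 H1]], H2 as [[T2 H2]|[T2 H2]]; try contradiction;
      [eapply IH1|eapply IH2]; eauto; tauto.
  - destruct H1 as [[T1 H1]|[T1 H1]], H2 as [[T2 H2]|[T2 H2]]; try contradiction;
      [eapply IH1|eapply IH2]; eauto; tauto.
  - destruct H1 as [H1 T1], H2 as [H2 T2].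
    eapply loop_deterministic; [|exact H1|exact T1|exact H2|exact T2].
    intros a b d _. now apply IH.
Qed.

Definition wp (O : list U -> U -> Prop) (c : cmd) (s : state) (P : state -> Prop) : Prop :=
  exists s', den O c s s' /\ P s'.

(** Passes from one exhibited outcome to all outcomes; soundness of terminating oracle-free commands
    is drawn from their total correctness in this way. *)
Lemma wp_den O c s P s' : oracle_free_cmd c -> wp O c s P -> den O c s s' -> P s'.
Proof.
  intros Hf (s1 & H1 & HP) H. now rewrite (den_deterministic O c Hf s s' s1).
Qed.

Lemma wp_mono O c s (P Q : state -> Prop) :
  wp O c s P -> (forall s', P s' -> Q s') -> wp O c s Q.
Proof. intros (s1 & H1 & HP) H. exists s1. auto. Qed.

Lemma wp_skip O s (P : state -> Prop) : P s -> wp O Skip s P.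
Proof. intros HP. now exists s. Qed.

Lemma wp_seq O c1 c2 s P : wp O c1 s (fun s1 => wp O c2 s1 P) -> wp O (Seq c1 c2) s P.
Proof. intros (s1 & H1 & s2 & H2 & HP). exists s2. split; [now exists s1|easy]. Qed.

Lemma wp_asg O r e s (P : state -> Prop) :
  P (upd (fst s) r (eval e (fst s)), snd s) -> wp O (Asg r e) s P.
Proof. intros HP. eexists; split; [reflexivity|easy]. Qed.

Lemma wp_zcopy O e1 e2 s (P : state -> Prop) :
  P (fst s, upd (snd s) (eval e1 (fst s)) (snd s (eval e2 (fst s)))) -> wp O (ZCopy e1 e2) s P.
Proof. intros HP. eexists; split; [reflexivity|easy]. Qed.

Lemma wp_ifeq O e1 e2 c1 c2 s (P : state -> Prop) :
  (evals_eq e1 e2 s -> wp O c1 s P) -> (~ evals_eq e1 e2 s -> wp O c2 s P) ->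
  wp O (IfEq e1 e2 c1 c2) s P.
Proof.
  intros H1 H2. destruct (Nat.eq_dec (eval e1 (fst s)) (eval e2 (fst s))) as [E|E].
  - destruct (H1 E) as (s' & Hd & HP). exists s'. split; [left; now split|easy].
  - destruct (H2 E) as (s' & Hd & HP). exists s'. split; [right; now split|easy].
Qed.

Lemma wp_while O e1 e2 c (I : nat -> state -> Prop) (P : state -> Prop) :
  (forall n s, I n s -> evals_eq e1 e2 s -> P s) ->
  (forall n s, I n s -> ~ evals_eq e1 e2 s ->
     wp O c s (fun s' => exists n', n' < n /\ I n' s')) ->
  forall n s, I n s -> wp O (While e1 e2 c) s P.
Proof.
  intros HP Hc n. induction n as [n IH] using lt_wf_ind. intros s Hs.
  destruct (Nat.eq_dec (eval e1 (fst s)) (eval e2 (fst s))) as [E|E].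
  - exists s. split; [split; [constructor|easy]|eauto].
  - destruct (Hc n s Hs E) as (s1 & Hd & n' & Hn & H1).
    destruct (IH n' Hn s1 H1) as (s2 & [Hd2 Ht2] & HP2). exists s2. split; [|easy].
    split; [|easy]. econstructor; eauto.
Qed.

(** Partial correctness, for a loop such as the witness search whose termination is not known in
    advance. *)
Lemma while_inv O e1 e2 c (I : state -> Prop) :
  (forall s s', I s -> ~ evals_eq e1 e2 s -> den O c s s' -> I s') ->
  forall s s', I s -> den O (While e1 e2 c) s s' -> I s' /\ evals_eq e1 e2 s'.
Proof.
  intros H s s' Hs [Hd Ht]. split; [|easy]. clear Ht.
  induction Hd as [|s s1 s' [Hn H1] _ IH]; eauto.
Qed.

(** * Computations of machines *)

(** Bounds directly addressed registers; the reach of a copy is governed by the index registers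
    instead. *)
Definition zbound (C : nat) (ins : instr A) : Prop :=
  match ins with
  | IFun j i args => j <= C /\ forall t, args t <= C
  | IConst j _ | IOracle j => j <= C
  | IRel i args _ _ => forall t, args t <= C
  | _ => True
  end.

Lemma fin_bounded n (f : Fin.t n -> nat) : exists C, forall t, f t <= C.
Proof.
  induction n as [|n IH].
  - exists 0. intros t. inversion t.
  - destruct (IH (fun t => f (Fin.FS t))) as [C HC]. exists (C + f Fin.F1).
    intros t. apply (Fin.caseS' t (fun t => f t <= C + f Fin.F1)); [lia|].
    intros p. specialize (HC p). lia.
Qed.

Lemma zbound_exists (P : list (instr A)) : exists C, 1 <= C /\ Forall (zbound C) P.
Proof.
  assert (mono : forall C C' ins, C <= C' -> zbound C ins -> zbound C' ins).
  { intros C C' [] HC; simpl; try tauto; try lia.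
    - intros [H1 H2]. split; [lia|]. intros t. specialize (H2 t). lia.
    - intros H2 t. specialize (H2 t). lia. }
  induction P as [|ins P (C & HC & IH)].
  - exists 1. auto.
  - assert (exists C1, zbound C1 ins) as [C1 H1].
    { destruct ins; simpl; try (now exists 0); try (now exists j).
      - destruct (fin_bounded _ args) as [C1 H1]. exists (C1 + j). split; [lia|].
        intros t. specialize (H1 t). lia.
      - apply fin_bounded. }
    exists (C + C1). split; [lia|]. constructor; [apply mono with C1; [lia|easy]|].
    eapply Forall_impl; [|exact IH]. intros a. apply mono. lia.
Qed.

Lemma step_inv ok O M c c' : wf_machine A ok M -> step O M c c' ->
  exists ins, nth_error (prog M) (lab c - 1) = Some ins /\ wf_instr A ok M ins /\
    In ins (prog M) /\ exec O ins c c' /\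
    1 <= lab c < length (prog M) /\ 1 <= lab c' <= length (prog M).
Proof.
  intros (_ & (P & HP & _) & Hw) (Hl & ins & Hn & He).
  pose proof (nth_error_In _ _ Hn) as Hin. pose proof (Hw ins Hin) as Hwi.
  assert (Hlt : lab c < length (prog M)).
  { assert (lab c - 1 < length (prog M)) by (apply nth_error_Some; congruence).
    destruct (Nat.eq_dec (lab c) (length (prog M))) as [E|]; [|lia].
    rewrite E, HP, length_app, nth_error_app2 in Hn by (simpl; lia). simpl in Hn.
    replace (length P + 1 - 1 - length P) with 0 in Hn by lia.
    injection Hn as <-. now apply exec_inv in He. }
  exists ins. repeat split; auto; apply exec_inv in He; unfold wf_instr, wf_lab in Hwi;
    destruct ins; simpl in He, Hwi; try contradiction;
    try (destruct He as (s' & _ & ->); simpl; lia);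
    destruct He as [[_ ->]|[_ ->]]; simpl; lia.
Qed.

Lemma final_no_step ok O M c c' : wf_machine A ok M -> lab c = length (prog M) ->
  ~ step O M c c'.
Proof.
  intros Hw Hf Hs. destruct (step_inv ok O M c c' Hw Hs) as (_ & _ & _ & _ & _ & H & _). lia.
Qed.

Lemma fetch ok M l : wf_machine A ok M -> 1 <= l < length (prog M) ->
  exists ins, nth_error (prog M) (l - 1) = Some ins /\ wf_instr A ok M ins /\
    In ins (prog M) /\ ~ is_stop A ins.
Proof.
  intros (_ & (P & HP & Hns) & Hw) Hl.
  destruct (nth_error (prog M) (l - 1)) as [ins|] eqn:E.
  - exists ins. pose proof (nth_error_In _ _ E) as Hin. repeat split; auto.
    apply Hns. rewrite HP, length_app in *. simpl in Hl.
    rewrite nth_error_app1 in E by lia. now apply nth_error_In in E.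
  - apply nth_error_None in E. lia.
Qed.

Definition is_oracle (ins : instr A) : Prop :=
  match ins with IOracle _ => True | _ => False end.

Lemma exec_total O ins c : ~ is_stop A ins -> ~ is_oracle ins -> exists c', exec O ins c c'.
Proof.
  destruct ins; simpl; intros H1 H2; try tauto; try (eexists; now constructor).
  - destruct (classic (rval A i (fun t => zreg c (args t)))).
    + eexists; now apply ExRelT.
    + eexists; now apply ExRelF.
  - destruct (Nat.eq_dec (ireg c j) (ireg c k)).
    + eexists; now apply ExIdxT.
    + eexists; now apply ExIdxF.
Qed.

Lemma exec_deterministic O ins c c1 c2 : ~ is_oracle ins ->
  exec O ins c c1 -> exec O ins c c2 -> c1 = c2.
Proof.
  intros Ho H1 H2. apply exec_inv in H1, H2.
  destruct ins; simpl in *; try tauto;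
    try (destruct H1 as (? & -> & ->), H2 as (? & -> & ->); reflexivity);
    destruct H1 as [[? ->]|[? ->]], H2 as [[? ->]|[? ->]]; tauto.
Qed.

(** With the empty oracle each configuration has at most one successor, and a final one has none, so
    no run gets past the halting configuration. *)
Lemma nsteps_halt_unique ok M p q c c1 c2 : wf_machine A ok M ->
  nsteps (fun _ _ => False) M p c c1 -> lab c1 = length (prog M) ->
  nsteps (fun _ _ => False) M q c c2 -> p <= q -> c2 = c1.
Proof.
  intros Hw. revert q c. induction p as [|p IH]; intros q c H1 Hf H2 Hpq; simpl in H1.
  - subst. destruct q as [|q]; simpl in H2; [easy|]. destruct H2 as (c' & Hs & _).
    now apply (final_no_step ok _ _ _ _ Hw Hf) in Hs.
  - destruct q as [|q]; [lia|]. simpl in H2.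
    destruct H1 as (d1 & (_ & i1 & N1 & E1) & H1), H2 as (d2 & (_ & i2 & N2 & E2) & H2).
    rewrite N1 in N2. injection N2 as <-.
    assert (d1 = d2) as <-.
    { apply exec_deterministic with (fun _ _ => False) i1 c; auto.
      intros Ho. destruct i1; try contradiction.
      apply exec_inv in E1. now destruct E1 as (? & (y & [] & _) & _). }
    apply IH with q d1; auto. lia.
Qed.

(* A computation of [n] steps only inspects the first [h + n] registers. *)
Lemma nsteps_agree M C B n : wf_machine A false M -> Forall (zbound C) (prog M) -> C <= B ->
  forall h c d c', h + n <= B -> lab c = lab d -> ireg c = ireg d ->
  (forall j, 1 <= j <= nidx M -> 1 <= ireg c j <= h) ->
  (forall a, 1 <= a <= B -> zreg c a = zreg d a) ->
  nsteps (fun _ _ => False) M n c c' ->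
  exists d', nsteps (fun _ _ => False) M n d d' /\ lab c' = lab d' /\ ireg c' = ireg d' /\
    (forall j, 1 <= j <= nidx M -> 1 <= ireg c' j <= B) /\
    (forall a, 1 <= a <= B -> zreg c' a = zreg d' a).
Proof.
  intros Hw HC HCB. induction n as [|n IH]; intros h c d c' Hh El Ei Hi Hz Hn; simpl in Hn.
  - subst c'. exists d. repeat split; auto; apply Hi in H; lia.
  - destruct Hn as (c1 & Hs & Hn).
    destruct (step_inv false _ M c c1 Hw Hs) as (ins & Hf & Hwi & Hin & He & Hl & _).
    rewrite Forall_forall in HC. pose proof (HC ins Hin) as HCi.
    rewrite <- Forall_forall in HC.
    enough (exists d1, exec (fun _ _ => False) ins d d1 /\ lab c1 = lab d1 /\ ireg c1 = ireg d1 /\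
      (forall j, 1 <= j <= nidx M -> 1 <= ireg c1 j <= S h) /\
      (forall a, 1 <= a <= B -> zreg c1 a = zreg d1 a)) as (d1 & He1 & El1 & Ei1 & Hi1 & Hz1).
    { destruct (IH (S h) c1 d1 c') as (d' & Hd' & H); auto; [lia|].
      exists d'. split; [|easy]. exists d1. split; [|easy].
      split; [lia|]. exists ins. split; [congruence|easy]. }
    assert (Hupd : forall j v, forall a, 1 <= a <= B -> upd (zreg c) j v a = upd (zreg d) j v a).
    { intros j v a Ha. unfold upd. destruct (Nat.eqb a j); auto. }
    assert (Hargs : forall m (args : Fin.t m -> nat), (forall t, wf_zreg (args t)) ->
      (forall t, args t <= C) -> (fun t => zreg c (args t)) = (fun t => zreg d (args t))).
    { intros m args H1 H2. extensionality t. apply Hz. specialize (H1 t).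
      specialize (H2 t). unfold wf_zreg in H1. lia. }
    assert (Hi' : forall j, 1 <= j <= nidx M -> 1 <= ireg c j <= S h)
      by (intros j Hj; specialize (Hi j Hj); lia).
    clear IH Hs Hn Hf Hl Hin HC.
    destruct He; simpl in Hwi, HCi; unfold wf_ireg in Hwi.
    + exists {| lab := S (lab d); ireg := ireg d;
        zreg := upd (zreg d) j (fval A i (fun t => zreg d (args t))) |}.
      split; [constructor|]. simpl. repeat split; auto; try now apply Hi'.
      rewrite (Hargs _ args); [now apply Hupd|easy|easy].
    + exists {| lab := S (lab d); ireg := ireg d; zreg := upd (zreg d) j (cval A i) |}.
      split; [constructor|]. simpl. repeat split; auto; now apply Hi'.
    + exists {| lab := S (lab d); ireg := ireg d;
        zreg := upd (zreg d) (ireg d j) (zreg d (ireg d k)) |}.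
      split; [constructor|]. simpl. repeat split; auto; try now apply Hi'.
      intros a Ha. rewrite <- Ei. rewrite <- (Hz (ireg c k)); [now apply Hupd|].
      specialize (Hi k ltac:(lia)). lia.
    + exists {| lab := l1; ireg := ireg d; zreg := zreg d |}.
      rewrite (Hargs _ args) in H by tauto.
      split; [now constructor|]. simpl. repeat split; auto; now apply Hi'.
    + exists {| lab := l2; ireg := ireg d; zreg := zreg d |}.
      rewrite (Hargs _ args) in H by tauto.
      split; [now apply ExRelF|]. simpl. repeat split; auto; now apply Hi'.
    + exists {| lab := l1; ireg := ireg d; zreg := zreg d |}.
      rewrite Ei in H. split; [now constructor|]. simpl. repeat split; auto; now apply Hi'.
    + exists {| lab := l2; ireg := ireg d; zreg := zreg d |}.
      rewrite Ei in H. split; [now apply ExIdxF|]. simpl. repeat split; auto; now apply Hi'.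
    + exists {| lab := S (lab d); ireg := upd (ireg d) j 1; zreg := zreg d |}.
      split; [constructor|]. simpl. repeat split; auto; try congruence;
        unfold upd; destruct (Nat.eqb j0 j); try lia; now apply Hi'.
    + exists {| lab := S (lab d); ireg := upd (ireg d) j (S (ireg d j)); zreg := zreg d |}.
      split; [constructor|]. simpl. specialize (Hi j ltac:(lia)). repeat split; auto; try congruence;
        unfold upd; destruct (Nat.eqb j0 j); try lia; now apply Hi'.
    + contradiction.
Qed.

(** * Guessed tuples as infinite streams *)

Definition init_tape (x : list U) (g : nat -> U) : Prop :=
  x <> [] /\ forall a, 1 <= a <= length x -> nth_error x (a - 1) = Some (g a).

(** A guessed tuple followed by padding is a particular stream. Conversely, a halting run sees
    boundedly many cells, so cutting the stream beyond them and padding it changes neither the run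
    nor its output. *)
Lemma Res_ND_stream M x y : ND_machine A M ->
  (Res_ND A M x y <-> exists g cf, init_tape x g /\
     reach (fun _ _ => False) M (mk 1 (init_idx (length x), g)) cf /\
     lab cf = length (prog M) /\ y = out cf).
Proof.
  intros Hw. split.
  - intros (c0 & cf & Hi & Hr & Hf & Hy). unfold init_nd in Hi.
    destruct x as [|b x]; [contradiction|]. destruct Hi as (w & Hwn & ->).
    eexists; exists cf. split; [|split; [exact Hr|auto]].
    split; [discriminate|]. intros a Ha. unfold fill.
    rewrite app_nth1 by lia. apply nth_error_nth'. lia.
  - intros (g & cf & [Hx Hg] & Hr & Hf & Hy). apply reach_nsteps in Hr as [n Hr].
    destruct (zbound_exists (prog M)) as (C & HC1 & HC).
    destruct x as [|b x'] eqn:Ex; [easy|]. rewrite <- Ex in *.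
    (* [B] covers the fixed registers and the input plus one further cell per step; the final 1
       makes the guessed tuple visibly nonempty. *)
    set (B := C + length x + n + 1).
    set (w := map g (seq (length x + 1) (B - length x))).
    assert (Hlx : 1 <= length x) by (destruct x; simpl; [easy|lia]).
    destruct (nsteps_agree M C B n Hw HC) with (h := length x)
      (c := mk 1 (init_idx (length x), g)) (c' := cf)
      (d := mk 1 (init_idx (length x), fill A (x ++ w) (last x b)))
      as (df & Hd & El & Ei & Hb & Hz); auto; try lia; simpl.
    { intros j Hj. unfold init_idx. destruct (Nat.eqb j 1); lia. }
    { intros a Ha. unfold fill. destruct (le_lt_dec a (length x)) as [Hl|Hl].
      - rewrite app_nth1 by lia. symmetry. apply nth_error_nth. apply Hg. lia.
      - rewrite app_nth2 by lia. unfold w.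
        rewrite nth_indep with (d' := g 0) by (rewrite length_map, length_seq; lia).
        rewrite map_nth, seq_nth by lia. f_equal. lia. }
    eexists; exists df. split; [|split; [apply reach_nsteps; eexists; exact Hd|]].
    + unfold init_nd. rewrite Ex. exists w. rewrite <- Ex. split; [|reflexivity].
      unfold w. replace (B - length x) with (S (C + n)) by lia. discriminate.
    + split; [congruence|]. rewrite Hy. unfold out. rewrite Ei. apply map_ext_in.
      intros a Ha. apply in_seq in Ha. rewrite <- Ei in Ha. apply Hz.
      specialize (Hb 1). destruct Hw as [Hw _]. lia.
Qed.

(** * Simulating a machine inside the while language *)

Section Simulator.
(* The simulated [Z_a] is kept at address [4 * a + r] and the simulated [I_j] in register [base + j]. *)
Context (M : machine A) (base pc r : nat) (orc : nat -> cmd).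

Definition phi (a : nat) : nat := 4 * a + r.
Definition phie (e : expr) : expr := EAdd (EMul (EC 4) e) (EC r).
Definition incpc : cmd := Asg pc (EAdd (ER pc) (EC 1)).

Definition sim_instr (ins : instr A) : cmd :=
  match ins with
  | IFun j i args => Seq (ZFun (phi j) i (fun t => phi (args t))) incpc
  | IConst j i => Seq (ZConst (phi j) i) incpc
  | ICopy j k => Seq (ZCopy (phie (ER (base + j))) (phie (ER (base + k)))) incpc
  | IRel i args l1 l2 => IfRel i (fun t => phi (args t)) (Asg pc (EC l1)) (Asg pc (EC l2))
  | IIdxEq j k l1 l2 =>
      IfEq (ER (base + j)) (ER (base + k)) (Asg pc (EC l1)) (Asg pc (EC l2))
  | ISet1 j => Seq (Asg (base + j) (EC 1)) incpc
  | IIncr j => Seq (Asg (base + j) (EAdd (ER (base + j)) (EC 1))) incpc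
  | IStop => Skip
  | IOracle j => orc j
  end.

Fixpoint switch (l : nat) (P : list (instr A)) : cmd :=
  match P with
  | [] => Skip
  | ins :: P => IfEq (ER pc) (EC l) (sim_instr ins) (switch (S l) P)
  end.

Definition sim_step : cmd := switch 1 (prog M).

(* [H] bounds the index registers; the tapes agree up to [h]. *)
Definition srel (H h : nat) (c : config A) (s : state) : Prop :=
  fst s pc = lab c /\
  (forall j, 1 <= j <= nidx M -> fst s (base + j) = ireg c j /\ 1 <= ireg c j <= H) /\
  (forall a, 1 <= a <= h -> snd s (phi a) = zreg c a).

(** Whatever is not a register or a track of the simulated machine survives, so several simulations
    can share the tape. *)
Definition sframe (s s' : state) : Prop :=
  (forall q, q <> pc -> ~ base < q <= base + nidx M -> fst s' q = fst s q) /\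
  (forall p, (forall a, p <> phi a) -> snd s' p = snd s p).

Lemma switch_at P l s s' O ins : l <= fst s pc -> nth_error P (fst s pc - l) = Some ins ->
  (den O (switch l P) s s' <-> den O (sim_instr ins) s s').
Proof.
  revert l. induction P as [|i P IH]; intros l Hl Hn.
  - now destruct (fst s pc - l).
  - simpl. unfold evals_eq. simpl. destruct (Nat.eq_dec (fst s pc) l) as [E|E].
    + rewrite E, Nat.sub_diag in Hn. injection Hn as ->. tauto.
    + rewrite <- (IH (S l)); [tauto|lia|].
      now replace (fst s pc - l) with (S (fst s pc - S l)) in Hn by lia.
Qed.

Lemma sim_step_at s s' O ins : 1 <= fst s pc -> nth_error (prog M) (fst s pc - 1) = Some ins ->
  (den O sim_step s s' <-> den O (sim_instr ins) s s').
Proof. apply switch_at. Qed.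

(** A step touches fixed registers, at most [C], and registers named by index registers, at most
    [h]; hence agreement up to [h] suffices and cells beyond [h] do not change. An index register
    may grow by 1, which gives the bound [S h] afterwards. The oracles [O] and [O'] may differ
    because no oracle instruction is executed. *)
Lemma sim_instr_exec ok O O' C h ins c c' s : pc <= base -> wf_instr A ok M ins ->
  zbound C ins -> C <= h -> ~ is_oracle ins -> exec O ins c c' -> srel h h c s ->
  wp O' (sim_instr ins) s (fun s' => srel (S h) h c' s' /\ sframe s s') /\
  (forall a, h < a -> zreg c' a = zreg c a).
Proof.
  intros Hpc Hwi HC HCh Ho He (Hl & Hi & Hz).
  assert (Hi' : forall j, 1 <= j <= nidx M ->
    fst s (base + j) = ireg c j /\ 1 <= ireg c j <= S h)
    by (intros j Hj; specialize (Hi j Hj); lia).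
  assert (Hargs : forall m (args : Fin.t m -> nat), (forall t, wf_zreg (args t)) ->
    (forall t, args t <= C) -> (fun t => snd s (phi (args t))) = (fun t => zreg c (args t))).
  { intros m args H1 H2. extensionality t. apply Hz. specialize (H1 t).
    specialize (H2 t). unfold wf_zreg in H1. lia. }
  (* All cases reduce to three effects: a write to the tape, a jump, an update of an index
     register. *)
  assert (Hwr : forall b v, b <= h -> exists s', den O' incpc (fst s, upd (snd s) (phi b) v) s' /\
    srel (S h) h {| lab := S (lab c); ireg := ireg c; zreg := upd (zreg c) b v |} s' /\
    sframe s s').
  { intros b v Hb. eexists. split; [reflexivity|]. unfold srel, sframe; simpl. split; [split; [|split]|split].
    - upds. lia.
    - intros j Hj. upds. auto.
    - intros a Ha. destruct (Nat.eq_dec a b) as [->|Hn].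
      + now rewrite !upd_eq.
      + rewrite !upd_neq; auto. unfold phi. lia.
    - intros q Hq _. now upds.
    - intros p Hp. now rewrite upd_neq. }
  assert (Hjmp : forall l, exists s', den O' (Asg pc (EC l)) s s' /\
    srel (S h) h {| lab := l; ireg := ireg c; zreg := zreg c |} s' /\ sframe s s').
  { intros l. eexists. split; [reflexivity|]. unfold srel, sframe; simpl. split; [split; [|split]|split];
    auto; intros; now upds; auto. }
  assert (Hidx : forall j v, 1 <= j <= nidx M -> 1 <= v <= S h -> exists s',
    den O' incpc (upd (fst s) (base + j) v, snd s) s' /\
    srel (S h) h {| lab := S (lab c); ireg := upd (ireg c) j v; zreg := zreg c |} s' /\
    sframe s s').
  { intros j v Hj Hv. eexists. split; [reflexivity|]. unfold srel, sframe; simpl. split; [split; [|split]|split];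
    auto.
    - upds. lia.
    - intros k Hk. rewrite upd_neq by lia. destruct (Nat.eq_dec k j) as [->|Hn].
      + now rewrite !upd_eq.
      + rewrite !upd_neq by lia. auto.
    - intros q Hq Hq2. now upds. }
  destruct He; simpl in Hwi, HC, Ho; unfold wf_ireg, wf_zreg in Hwi; simpl zreg;
    split; try (intros; reflexivity); try (intros; apply upd_neq; try lia);
    try apply wp_seq.
  - rewrite <- (Hargs _ args) by tauto.
    destruct (Hwr j (fval A i (fun t => snd s (phi (args t)))) ltac:(lia)) as (s' & Hd & H).
    eexists. split; [reflexivity|]. exists s'. split; [exact Hd|exact H].
  - destruct (Hwr j (cval A i) ltac:(lia)) as (s' & Hd & H).
    eexists. split; [reflexivity|]. exists s'. split; [exact Hd|exact H].
  - pose proof (Hi j ltac:(tauto)) as [Ej Hj]. pose proof (Hi k ltac:(tauto)) as [Ek Hk].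
    rewrite <- (Hz (ireg c k)) by lia.
    destruct (Hwr (ireg c j) (snd s (phi (ireg c k))) ltac:(lia)) as (s' & Hd & H).
    apply wp_zcopy. exists s'. split; [|exact H]. cbn [phie eval]. rewrite Ej, Ek. exact Hd.
  - specialize (Hi j ltac:(tauto)). lia.
  - destruct (Hjmp l1) as (s' & Hd & Hs). exists s'. split; [|exact Hs].
    left. rewrite (Hargs _ args) by tauto. split; [exact H|exact Hd].
  - destruct (Hjmp l2) as (s' & Hd & Hs). exists s'. split; [|exact Hs].
    right. rewrite (Hargs _ args) by tauto. split; [exact H|exact Hd].
  - destruct (Hjmp l1) as (s' & Hd & Hs). exists s'. split; [|exact Hs].
    left. split; [|exact Hd]. unfold evals_eq; simpl.
    now rewrite (proj1 (Hi j ltac:(tauto))), (proj1 (Hi k ltac:(tauto))).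
  - destruct (Hjmp l2) as (s' & Hd & Hs). exists s'. split; [|exact Hs].
    right. split; [|exact Hd]. unfold evals_eq; simpl.
    now rewrite (proj1 (Hi j ltac:(tauto))), (proj1 (Hi k ltac:(tauto))).
  - apply wp_asg. apply Hidx; [tauto|simpl; lia].
  - apply wp_asg. pose proof (Hi j ltac:(tauto)) as [Ej Hj]. simpl. rewrite Ej, Nat.add_1_r.
    apply Hidx; [tauto|lia].
  - tauto.
Qed.

Lemma sim_step_oracle_free :
  (forall j, In (IOracle j) (prog M) -> oracle_free_cmd (orc j)) -> oracle_free_cmd sim_step.
Proof.
  unfold sim_step. generalize 1. induction (prog M) as [|i P IH]; intros l Ho; simpl; [exact I|].
  split.
  - destruct i; simpl; auto. apply Ho. now left.
  - apply IH. intros j Hj. apply Ho. now right.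
Qed.

Lemma sim_step_wf ok ok' tau : wf_machine A ok M -> 1 <= r -> 1 <= pc < tau ->
  base + nidx M < tau ->
  (forall j, In (IOracle j) (prog M) -> 1 <= j -> wf ok' tau (orc j)) -> wf ok' tau sim_step.
Proof.
  intros (_ & _ & Hw) Hr Hpc Hb Horc. unfold sim_step.
  assert (H1 : 1 <= 1) by lia. revert H1. generalize 1 at 2 3.
  induction (prog M) as [|i P IH] in Hw, Horc |- *; intros l Hl; simpl; [exact I|].
  split; [lia|]. split; [lia|]. split.
  - assert (Hi : wf_instr A ok M i) by (apply Hw; now left).
    assert (Ho : forall j, i = IOracle j -> 1 <= j -> wf ok' tau (orc j)).
    { intros j Hj. apply Horc. now left. }
    destruct i; simpl in Hi |- *; unfold wf_zreg, wf_ireg, wf_lab, phi in *; auto;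
      repeat split; try lia; try (intros; lia).
    now apply Ho.
  - apply IH; [| |lia].
    + intros ins Hi. apply Hw. now right.
    + intros j Hj. apply Horc. now right.
Qed.
End Simulator.

(** * Moving data between the tracks *)

(* Register 4 is the counter of the copying loops. *)
Definition for_copy (bound dst src : expr) : cmd :=
  Seq (Asg 4 (EC 1))
    (While (ER 4) (EAdd bound (EC 1)) (Seq (ZCopy dst src) (Asg 4 (EAdd (ER 4) (EC 1))))).

(** [D] and [S] are the addresses as functions of the counter. The condition relating them protects
    only sources that are still to be read, so overlapping upward moves are allowed. *)
Lemma wp_for_copy O bound dst src (N : nat) (D S : nat -> nat) (s : state) (P : state -> Prop) :
  (forall i, (forall q, q <> 4 -> i q = fst s q) ->
     eval bound i = N /\ eval dst i = D (i 4) /\ eval src i = S (i 4)) ->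
  (forall a b, 1 <= a < b -> b <= N -> D a <> D b) ->
  (forall a b, 1 <= a < b -> b <= N -> D a <> S b) ->
  (forall s', (forall q, q <> 4 -> fst s' q = fst s q) ->
     (forall a, 1 <= a <= N -> snd s' (D a) = snd s (S a)) ->
     (forall p, (forall a, 1 <= a <= N -> p <> D a) -> snd s' p = snd s p) -> P s') ->
  wp O (for_copy bound dst src) s P.
Proof.
  intros He HD HS HP. apply wp_seq, wp_asg.
  apply wp_while with (n := N) (I := fun n s' =>
    1 <= fst s' 4 /\ fst s' 4 + n = N + 1 /\ (forall q, q <> 4 -> fst s' q = fst s q) /\
    (forall a, 1 <= a < fst s' 4 -> snd s' (D a) = snd s (S a)) /\
    (forall p, (forall a, 1 <= a < fst s' 4 -> p <> D a) -> snd s' p = snd s p)).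
  - intros n [i z] (H1 & H2 & Hq & Hz & Hf) E. unfold evals_eq in E. simpl in *.
    rewrite (proj1 (He i Hq)) in E. apply HP; auto.
    + intros a Ha. apply Hz. simpl. lia.
    + intros p Hp. apply Hf. intros a Ha. apply Hp. simpl in *. lia.
  - intros n [i z] (H1 & H2 & Hq & Hz & Hf) E. unfold evals_eq in E. simpl in *.
    destruct (He i Hq) as (Eb & Ed & Es). rewrite Eb in E.
    apply wp_seq, wp_zcopy, wp_asg. simpl. exists (n - 1). split; [lia|].
    rewrite !upd_eq, Ed, Es. split; [lia|]. split; [lia|]. split; [|split].
    + intros q Hq4. now upds; auto.
    + intros a Ha. destruct (Nat.eq_dec a (i 4)) as [->|Hn].
      * rewrite upd_eq. apply Hf. intros b Hb E2. apply (HS b (i 4)); auto; lia.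
      * rewrite upd_neq by (apply HD; lia). apply Hz. lia.
    + intros p Hp. rewrite upd_neq by (apply Hp; lia). apply Hf. intros a Ha. apply Hp. lia.
  - simpl. rewrite !upd_eq. split; [lia|]. split; [lia|]. split; [|split].
    + intros q Hq. now upds.
    + intros a Ha. lia.
    + easy.
Qed.

(* Registers: 1 holds the input length, 2 the program counter and 3 the number of
   initialised cells of the simulated machine, whose index registers start at 21; [Z_8] keeps the last input.
   The intermediate copy of the input lies above its destination, so that both passes
   run upwards without overwriting unread cells. *)
Definition load : cmd :=
  let far := EAdd (phie 1 (ER 1)) (ER 4) in
  Seq (for_copy (ER 1) far (ER 4))
    (Seq (for_copy (ER 1) (phie 1 (ER 4)) far)
      (Seq (ZCopy (EC 8) (phie 1 (ER 1))) (Seq (Asg 21 (ER 1)) (Asg 3 (ER 1))))).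

Definition unload : cmd := Seq (Asg 1 (ER 21)) (for_copy (ER 1) (ER 4) (phie 1 (ER 4))).

(** The bound [5 * n + 1] is [phi 1 n + n], the last cell of the intermediate copy; apart from
    [Z_8], the guesses beyond it are preserved. *)
Lemma wp_load O n (g : nat -> U) (P : state -> Prop) : 1 <= n ->
  (forall s', (forall q, q <> 4 -> fst s' q = if orb (Nat.eqb q 1) (orb (Nat.eqb q 3) (Nat.eqb q 21)) then n else 1) ->
     (forall a, 1 <= a <= n -> snd s' (phi 1 a) = g a) -> snd s' 8 = g n ->
     (forall p, 5 * n + 1 < p -> p <> 8 -> snd s' p = g p) -> P s') ->
  wp O load (init_idx n, g) P.
Proof.
  intros Hn HP. apply wp_seq.
  apply wp_for_copy with (N := n) (D := fun a => phi 1 n + a) (S := fun a => a); simpl.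
  { intros i Hi. unfold phi. rewrite (Hi 1) by lia. unfold init_idx. simpl. lia. }
  { intros; lia. }
  { unfold phi; intros; lia. }
  intros s1 Hq1 Hz1 Hf1. apply wp_seq.
  apply wp_for_copy with (N := n) (D := phi 1) (S := fun a => phi 1 n + a); simpl.
  { intros i Hi. unfold phi. rewrite (Hi 1), (Hq1 1) by lia. unfold init_idx. simpl. lia. }
  { unfold phi; intros; lia. }
  { unfold phi; intros; lia. }
  intros s2 Hq2 Hz2 Hf2.
  assert (Hi2 : forall q, q <> 4 -> fst s2 q = init_idx n q).
  { intros q Hq. now rewrite Hq2, Hq1. }
  apply wp_seq, wp_zcopy, wp_seq, wp_asg, wp_asg. simpl.
  rewrite !(upd_neq _ 21), (Hi2 1) by lia. change (init_idx n 1) with n.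
  assert (Hcell : forall a, 1 <= a <= n -> snd s2 (phi 1 a) = g a).
  { intros a Ha. rewrite Hz2, Hz1; auto. }
  apply HP; simpl.
  - intros q Hq. unfold upd. destruct (Nat.eqb_spec q 3) as [->|H3]; [easy|].
    destruct (Nat.eqb_spec q 21) as [->|H21]; [easy|]. rewrite Hi2 by easy.
    unfold init_idx. now destruct (Nat.eqb_spec q 1).
  - intros a Ha. rewrite upd_neq by (unfold phi; lia). auto.
  - rewrite upd_eq. apply (Hcell n). lia.
  - intros p Hp Hp4. rewrite upd_neq by easy.
    rewrite Hf2, Hf1; [easy| |]; unfold phi; intros a Ha; lia.
Qed.

Lemma wp_unload O (s : state) :
  wp O unload s (fun s' => out (mk 0 s') = map (fun a => snd s (phi 1 a)) (seq 1 (fst s 21))).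
Proof.
  apply wp_seq, wp_asg.
  apply wp_for_copy with (N := fst s 21) (D := fun a => a) (S := phi 1); simpl.
  { intros i Hi. unfold phi. rewrite (Hi 1), upd_eq by lia. lia. }
  { intros; lia. }
  { unfold phi; intros; lia. }
  intros s1 Hq1 Hz1 _. unfold out. simpl. rewrite Hq1, upd_eq by lia.
  apply map_ext_in. intros a Ha. apply in_seq in Ha. apply Hz1. lia.
Qed.

Lemma unload_oracle_free : oracle_free_cmd unload.
Proof. simpl. tauto. Qed.

Lemma load_oracle_free : oracle_free_cmd load.
Proof. simpl. tauto. Qed.

(** * Simulation of non-deterministic machines by oracle machines *)

Section GuessByOracle.
Context (M : machine A) (C : nat) (HM : wf_machine A false M)
  (HC : Forall (zbound C) (prog M)).

(* The cells of the simulated tape are guessed when they first come into reach. *)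
Definition guess_next : cmd :=
  Seq (Asg 3 (EAdd (ER 3) (EC 1))) (Seq (ZOracle 8) (ZCopy (phie 1 (ER 3)) (EC 8))).

Definition guess_step : cmd := Seq (sim_step M 20 2 1 (fun _ => Skip)) guess_next.

Definition guess_prog : cmd :=
  Seq load (Seq (Nat.iter C (Seq guess_next) Skip)
    (Seq (While (ER 2) (EC (length (prog M))) guess_step) unload)).

Local Notation O1 := (nuQ A (Uinf A)).
Local Notation O0 := (fun (_ : list U) (_ : U) => False).

(** Any query extended by any element is nonempty, so the answer is a free guess whatever the
    registers contain. *)
Lemma oracle_univ z y : O1 z y.
Proof. exists []. unfold Uinf. now destruct z. Qed.

Lemma guess_next_den s s' : den O1 guess_next s s' <-> exists y,
  s' = (upd (fst s) 3 (S (fst s 3)), upd (upd (snd s) 8 y) (phi 1 (S (fst s 3))) y).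
Proof.
  simpl. split.
  - intros (s1 & -> & s2 & (y & _ & ->) & ->). exists y. simpl.
    now rewrite !upd_eq, (Nat.add_comm (fst s 3) 1).
  - intros (y & ->). eexists. split; [reflexivity|]. eexists. split.
    + exists y. split; [apply oracle_univ|reflexivity].
    + simpl. now rewrite !upd_eq, (Nat.add_comm (fst s 3) 1).
Qed.

(** Register 3 is the frontier of the initialised cells; fixed registers and index registers stay
    within it. *)
Definition grel (c : config A) (s : state) : Prop :=
  srel M 20 2 1 (fst s 3) (fst s 3) c s /\ C <= fst s 3 /\ 1 <= lab c <= length (prog M).

(** One new cell per step lets the frontier catch up with the index registers, which may have grown
    by 1. *)
Lemma guess_next_srel c s s' : srel M 20 2 1 (S (fst s 3)) (fst s 3) c s ->
  den O1 guess_next s s' -> zreg c (S (fst s 3)) = snd s' (phi 1 (S (fst s 3))) ->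
  srel M 20 2 1 (fst s' 3) (fst s' 3) c s'.
Proof.
  intros (Hl & Hi & Hz) Hd Hy. apply guess_next_den in Hd as (y & ->). simpl in *.
  rewrite upd_eq in Hy. unfold srel; simpl. upds. split; [easy|]. split.
  - intros j Hj. upds. auto.
  - intros a Ha. destruct (Nat.eq_dec a (S (fst s 3))) as [->|Hn].
    + now rewrite upd_eq.
    + rewrite !upd_neq by (unfold phi; lia). apply Hz. lia.
Qed.

Lemma guess_step_simulates c s ins c' : grel c s ->
  nth_error (prog M) (lab c - 1) = Some ins -> exec O0 ins c c' ->
  1 <= lab c' <= length (prog M) ->
  (exists s1, den O1 (sim_step M 20 2 1 (fun _ => Skip)) s s1 /\
     srel M 20 2 1 (S (fst s 3)) (fst s 3) c' s1 /\ fst s1 3 = fst s 3) /\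
  (forall a, fst s 3 < a -> zreg c' a = zreg c a).
Proof.
  intros (Hs & Hh & Hlc) Hn He Hlc'. pose proof (nth_error_In _ _ Hn) as Hin.
  assert (Hwi : wf_instr A false M ins) by (now apply (proj2 (proj2 HM))).
  pose proof HC as HC'. rewrite Forall_forall in HC'.
  destruct (sim_instr_exec M 20 2 1 (fun _ => Skip) false O0 O1 C (fst s 3) ins c c' s)
    as [(s1 & Hd & Hr & Hf) Hz]; auto; try lia.
  { destruct ins; simpl in *; auto. now destruct Hwi. }
  split; [|easy]. exists s1. split; [|split].
  - apply (sim_step_at M 20 2 1 (fun _ => Skip) s s1 O1 ins); auto; destruct Hs as (-> & _ & _); auto. lia.
  - easy.
  - apply Hf; lia.
Qed.

Lemma guess_step_complete c s c' : grel c s -> step O0 M c c' ->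
  exists s', den O1 guess_step s s' /\ grel c' s' /\ fst s 2 <> length (prog M).
Proof.
  intros Hg Hs. pose proof Hg as (Hr & Hh & Hlc).
  destruct (step_inv false O0 M c c' HM Hs) as (ins & Hn & _ & _ & He & Hl & Hl').
  destruct (guess_step_simulates c s ins c') as [(s1 & Hd1 & Hr1 & H3) _]; auto.
  assert (Hd2 := proj2 (guess_next_den s1 _) (ex_intro _ (zreg c' (S (fst s 3))) eq_refl)).
  eexists. split; [exists s1; split; [exact Hd1|exact Hd2]|].
  split; [|destruct Hr as (-> & _ & _); lia].
  split.
  - eapply guess_next_srel; [now rewrite H3|exact Hd2|]. simpl. now rewrite upd_eq, H3.
  - simpl. upds. lia.
Qed.

(** The simulated machine owns its whole guess from the start, so [c] must already contain, in the
    cell just beyond the frontier, the element that this pass is about to guess. *)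
Lemma guess_step_sound c s s' : grel c s -> fst s 2 <> length (prog M) ->
  den O1 guess_step s s' -> zreg c (S (fst s 3)) = snd s' (phi 1 (S (fst s 3))) ->
  exists c', step O0 M c c' /\ grel c' s' /\ fst s' 3 = S (fst s 3) /\
    forall a, fst s 3 < a -> zreg c' a = zreg c a.
Proof.
  intros Hg Hne (s1 & Hd1 & Hd2) Hy. pose proof Hg as ((Hl & Hi & Hz) & Hh & Hlc).
  destruct (fetch false M (lab c) HM) as (ins & Hn & Hwi & Hin & Hns); [lia|].
  assert (Ho : ~ is_oracle ins) by (destruct ins; simpl in *; auto; now destruct Hwi).
  destruct (exec_total O0 ins c Hns Ho) as [c' He].
  assert (Hs : step O0 M c c') by (split; [lia|]; now exists ins).
  destruct (step_inv false O0 M c c' HM Hs) as (_ & _ & _ & _ & _ & _ & Hl').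
  destruct (guess_step_simulates c s ins c') as [(s1' & Hd1' & Hr1 & H3) Hfar]; auto.
  assert (s1' = s1) as ->.
  { eapply den_deterministic; [|exact Hd1'|exact Hd1]. now apply sim_step_oracle_free. }
  exists c'. split; [easy|].
  assert (H3' : fst s' 3 = S (fst s 3)).
  { apply guess_next_den in Hd2 as (y & ->). simpl. now rewrite upd_eq, H3. }
  split; [|split; [easy|exact Hfar]].
  split; [|lia]. apply guess_next_srel with s1; rewrite ?H3; auto.
  rewrite Hfar by lia. exact Hy.
Qed.

Lemma guess_loop_complete c c' s : grel c s -> reach O0 M c c' -> lab c' = length (prog M) ->
  exists s', den O1 (While (ER 2) (EC (length (prog M))) guess_step) s s' /\ grel c' s'.
Proof.
  intros Hg Hr Hf. apply clos_rt_rt1n in Hr. revert s Hg.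
  induction Hr as [c|c c1 c' Hs _ IH]; intros s Hg.
  - exists s. split; [|easy]. split; [constructor|]. unfold evals_eq; simpl.
    destruct Hg as ((-> & _) & _). easy.
  - destruct (guess_step_complete c s c1 Hg Hs) as (s1 & Hd & Hg1 & Hne).
    destruct (IH Hf s1 Hg1) as (s2 & [Hd2 Ht] & Hg2). exists s2. split; [|easy].
    split; [|easy]. econstructor; [|exact Hd2]. now split.
Qed.

(** The stream is read off the complete run before [c] is chosen, because later guesses are part of
    the tape that [c] starts with; this dictates the order of the quantifiers. *)
Lemma guess_loop_sound s s' : den O1 (While (ER 2) (EC (length (prog M))) guess_step) s s' ->
  exists g, forall c, grel c s -> (forall a, fst s 3 < a -> zreg c a = g a) ->
    exists c', reach O0 M c c' /\ grel c' s' /\ lab c' = length (prog M).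
Proof.
  intros [Hd Ht]. unfold evals_eq in Ht. simpl in Ht.
  induction Hd as [s|s s1 s' [Hne Hd] _ IH].
  (* The run is over and inspects no further cell, so any stream will do. *)
  - exists (snd s). intros c Hg _. exists c. split; [apply rt_refl|]. split; [easy|].
    destruct Hg as ((<- & _) & _). easy.
  - destruct (IH Ht) as [g Hg].
    exists (fun a => if Nat.eqb a (S (fst s 3)) then snd s1 (phi 1 a) else g a).
    intros c Hc Hz.
    destruct (guess_step_sound c s s1) as (c1 & Hs & Hc1 & H3 & Hz1); auto.
    { rewrite Hz, Nat.eqb_refl by lia. reflexivity. }
    destruct (Hg c1) as (c' & Hr & H); auto.
    { intros a Ha. rewrite Hz1, Hz by lia. destruct (Nat.eqb_spec a (S (fst s 3))); [lia|easy]. }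
    exists c'. split; [|easy]. apply rt_trans with c1; [now apply rt_step|easy].
Qed.

Lemma guess_init_complete k s (g : nat -> U) :
  exists s', den O1 (Nat.iter k (Seq guess_next) Skip) s s' /\ fst s' 3 = fst s 3 + k /\
    (forall q, q <> 3 -> fst s' q = fst s q) /\
    (forall a, a <= fst s 3 -> snd s' (phi 1 a) = snd s (phi 1 a)) /\
    (forall a, fst s 3 < a <= fst s 3 + k -> snd s' (phi 1 a) = g a).
Proof.
  revert s. induction k as [|k IH]; intros s.
  - exists s. repeat split; auto; intros; lia.
  - assert (Hd := proj2 (guess_next_den s _) (ex_intro _ (g (S (fst s 3))) eq_refl)).
    match type of Hd with den _ _ _ ?t => destruct (IH t) as (s' & Hd' & H3 & Hq & Hz1 & Hz2) end.
    exists s'. cbn [fst snd] in H3, Hq, Hz1, Hz2. rewrite upd_eq in H3, Hz1, Hz2. repeat split.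
    + eexists. split; [exact Hd|exact Hd'].
    + lia.
    + intros q Hq3. rewrite Hq by easy. now upds.
    + intros a Ha. rewrite Hz1 by lia. now rewrite !upd_neq by (unfold phi; lia).
    + intros a Ha. destruct (Nat.eq_dec a (S (fst s 3))) as [->|Hn].
      * rewrite Hz1 by lia. now rewrite upd_eq.
      * apply Hz2. lia.
Qed.

Lemma guess_init_sound k s s' : den O1 (Nat.iter k (Seq guess_next) Skip) s s' ->
  fst s' 3 = fst s 3 + k /\ (forall q, q <> 3 -> fst s' q = fst s q) /\
  (forall a, a <= fst s 3 -> snd s' (phi 1 a) = snd s (phi 1 a)).
Proof.
  revert s. induction k as [|k IH]; intros s Hd.
  - simpl in Hd. subst. repeat split; auto.
  - destruct Hd as (s1 & Hd1 & Hd2). apply guess_next_den in Hd1 as (y & ->).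
    apply IH in Hd2 as (H3 & Hq & Hz). cbn [fst snd] in H3, Hq, Hz. rewrite upd_eq in H3, Hz.
    repeat split; [lia| |].
    + intros q Hq3. rewrite Hq by easy. now upds.
    + intros a Ha. rewrite Hz by lia. now rewrite !upd_neq by (unfold phi; lia).
Qed.

Lemma unload_out c s : grel c s ->
  map (fun a => snd s (phi 1 a)) (seq 1 (fst s 21)) = out c.
Proof.
  intros ((_ & Hi & Hz) & _ & _). unfold out. destruct (Hi 1) as [E1 Hb1].
  { destruct HM. lia. }
  simpl in E1. rewrite E1. apply map_ext_in. intros a Ha. apply in_seq in Ha. apply Hz. lia.
Qed.

Lemma init_grel n (g : nat -> U) s : 1 <= n -> fst s 3 = n + C -> fst s 21 = n ->
  (forall q, q = 2 \/ 21 < q -> fst s q = 1) ->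
  (forall a, 1 <= a <= n + C -> snd s (phi 1 a) = g a) ->
  grel (mk 1 (init_idx n, g)) s.
Proof.
  intros Hn H3 H21 Hq Hz. unfold grel, srel. simpl. rewrite H3.
  split; [split; [|split]|split]; auto.
  - intros j Hj. unfold init_idx. destruct (Nat.eqb_spec j 1) as [->|Hj1].
    + simpl. lia.
    + rewrite Hq by lia. lia.
  - lia.
  - destruct HM as (_ & (P & -> & _) & _). rewrite length_app. simpl. lia.
Qed.

Lemma guess_prog_correct x y g0 : init_tape x g0 ->
  (exists g cf, init_tape x g /\ reach O0 M (mk 1 (init_idx (length x), g)) cf /\
     lab cf = length (prog M) /\ y = out cf) <->
  (exists s', den O1 guess_prog (init_idx (length x), g0) s' /\ y = out (mk 0 s')).
Proof.
  intros Hg0.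
  assert (Hn : 1 <= length x) by (destruct Hg0 as [Hg _]; destruct x; simpl; [easy|lia]).
  split.
  - intros (g & cf & Hg & Hr & Hf & ->).
    enough (wp O1 guess_prog (init_idx (length x), g0) (fun s' => out cf = out (mk 0 s')))
      as (s' & Hd & Ho) by eauto.
    apply wp_seq, wp_load; auto. intros s1 Hq1 Hz1 _ _. apply wp_seq.
    destruct (guess_init_complete C s1 g) as (s2 & Hd2 & H3 & Hq2 & Hz2 & Hz2').
    exists s2. split; [exact Hd2|]. rewrite (Hq1 3) in H3, Hz2, Hz2' by lia. simpl in H3, Hz2, Hz2'.
    assert (Hrel : grel (mk 1 (init_idx (length x), g)) s2).
    { apply init_grel; auto.
      - now rewrite Hq2, Hq1 by lia.
      - intros q Hq. rewrite Hq2, Hq1 by lia.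
        destruct (Nat.eqb_spec q 1), (Nat.eqb_spec q 3), (Nat.eqb_spec q 21); simpl; try lia.
      - intros a Ha. destruct (le_lt_dec a (length x)).
        + rewrite Hz2, Hz1 by lia. destruct Hg as [_ Hg], Hg0 as [_ Hg0].
          specialize (Hg a). specialize (Hg0 a). rewrite Hg in Hg0 by lia.
          injection Hg0; auto; lia.
        + apply Hz2'. lia. }
    destruct (guess_loop_complete _ _ _ Hrel Hr Hf) as (s3 & Hd3 & Hrel3).
    apply wp_seq. exists s3. split; [exact Hd3|].
    eapply wp_mono; [apply wp_unload|]. intros s4 Ho. simpl in Ho. rewrite Ho. symmetry.
    now apply unload_out.
  - intros (s' & Hd & ->). destruct Hd as (s1 & Hd1 & s2 & Hd2 & s3 & Hd3 & Hd4).
    destruct (wp_den O1 load (init_idx (length x), g0) (fun s' =>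
      (forall q, q <> 4 -> fst s' q = if orb (Nat.eqb q 1) (orb (Nat.eqb q 3) (Nat.eqb q 21)) then length x else 1) /\
      (forall a, 1 <= a <= length x -> snd s' (phi 1 a) = g0 a)) s1 load_oracle_free) as [Hq1 Hz1]; auto.
    { apply wp_load; auto. }
    apply guess_init_sound in Hd2 as (H3 & Hq2 & Hz2).
    rewrite (Hq1 3) in H3, Hz2 by lia. simpl in H3, Hz2.
    destruct (guess_loop_sound s2 s3 Hd3) as [g1 Hg1].
    (* The input and the [C] initial guesses are taken from [s2], all later guesses from the run of
       the loop. *)
    set (g2 := fun a => if Nat.leb a (length x + C) then snd s2 (phi 1 a) else g1 a).
    assert (Hrel : grel (mk 1 (init_idx (length x), g2)) s2).
    { apply init_grel; auto.
      - now rewrite Hq2, Hq1 by lia.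
      - intros q Hq. rewrite Hq2, Hq1 by lia.
        destruct (Nat.eqb_spec q 1), (Nat.eqb_spec q 3), (Nat.eqb_spec q 21); simpl; try lia.
      - intros a Ha. unfold g2. destruct (Nat.leb_spec a (length x + C)); [easy|lia]. }
    destruct (Hg1 _ Hrel) as (cf & Hr & Hrel3 & Hf).
    { intros a Ha. simpl. unfold g2. destruct (Nat.leb_spec a (length x + C)); [lia|easy]. }
    exists g2, cf. split; [|split; [exact Hr|split; [exact Hf|]]].
    + split; [now destruct Hg0|]. intros a Ha. rewrite (proj2 Hg0 a Ha). f_equal. unfold g2.
      destruct (Nat.leb_spec a (length x + C)); [|lia]. rewrite Hz2, Hz1; auto. lia.
    + rewrite <- (unload_out cf s3 Hrel3).
      apply (wp_den O1 unload s3 _ s' unload_oracle_free (wp_unload O1 s3) Hd4).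
Qed.
End GuessByOracle.

(** * Answering oracle queries by guessing and dovetailing *)

Lemma nsteps_snoc O M n (c c1 c2 : config A) :
  nsteps O M n c c1 -> step O M c1 c2 -> nsteps O M (S n) c c2.
Proof.
  revert c. induction n as [|n IH]; intros c H Hs.
  - simpl in H. subst. now exists c2.
  - destruct H as (d & Hd & H). exists d. split; [easy|]. now apply IH.
Qed.

Fixpoint reset (b K : nat) : cmd :=
  match K with
  | 0 => Skip
  | S K => Seq (Asg (b + S K) (EC 1)) (reset b K)
  end.

Lemma wp_reset O b K (s : state) (P : state -> Prop) :
  (forall i', (forall q, b < q <= b + K -> i' q = 1) ->
     (forall q, ~ b < q <= b + K -> i' q = fst s q) -> P (i', snd s)) ->
  wp O (reset b K) s P.
Proof.
  revert s. induction K as [|K IH]; intros s HP.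
  - apply wp_skip. destruct s. apply HP; intros; [lia|easy].
  - apply wp_seq, wp_asg, IH. cbn [fst snd eval]. intros i' H1 H2. apply HP.
    + intros q Hq. destruct (Nat.eq_dec q (b + S K)) as [->|Hn].
      * rewrite H2, upd_eq by lia. easy.
      * apply H1. lia.
    + intros q Hq. rewrite H2 by lia. now upds.
Qed.

(* Injective in the query number [k >= 1] and the position [a >= 1], and beyond the area used by [load]. *)
Definition guess_addr (n k a : nat) : nat := phi 3 (2 * n + (k + a) * (k + a) + a).
Definition guess_expr (e : expr) : expr :=
  phie 3 (EAdd (EAdd (EMul (EC 2) (ER 1)) (EMul (EAdd (ER 5) e) (EAdd (ER 5) e))) e).
Lemma guess_addr_off n k a r b : r < 3 -> guess_addr n k a <> phi r b.
Proof. unfold guess_addr, phi. generalize (2 * n + (k + a) * (k + a) + a). intros; lia. Qed.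

Definition guessed (s : state) (a : nat) : U := snd s (guess_addr (fst s 1) (fst s 5) a).

Lemma eval_guess_expr e i : eval (guess_expr e) i = guess_addr (i 1) (i 5) (eval e i).
Proof. unfold guess_addr, phi. simpl. lia. Qed.

(** The pending oracle query of the simulated machine, followed by the prefix of length [m] of the
    current guess stream: a candidate for membership in the oracle set. *)
Definition query (s : state) (m : nat) : list U :=
  map (fun a => snd s (phi 1 a)) (seq 1 (fst s 21)) ++ map (guessed s) (seq 1 m).

Definition start (L : list U) (d : U) : config A :=
  mk 1 (init_idx (length L), fill A L (last L d)).

Lemma last_default (L : list U) d d' : L <> [] -> last L d = last L d'.
Proof.
  intros H. induction L as [|a L IH]; [easy|]. destruct L as [|b L]; [easy|].
  change (last (b :: L) d = last (b :: L) d'). now apply IH.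
Qed.

Lemma query_length s m : length (query s m) = fst s 21 + m.
Proof. unfold query. now rewrite length_app, !length_map, !length_seq. Qed.

Lemma query_last s m d : 1 <= m -> last (query s m) d = guessed s m.
Proof.
  intros Hm. unfold query. destruct m as [|m]; [lia|].
  rewrite seq_S, map_app, app_assoc. apply last_last.
Qed.

(** The machine for the oracle set pads its tape with its last input, which is here the [m]-th
    guess. *)
Lemma query_tape s m d a : 1 <= m -> 1 <= a ->
  fill A (query s m) (last (query s m) d) a =
    if a <=? fst s 21 then snd s (phi 1 a)
    else if a <=? fst s 21 + m then guessed s (a - fst s 21) else guessed s m.
Proof.
  intros Hm Ha. rewrite query_last by easy. unfold fill, query.
  destruct (Nat.leb_spec a (fst s 21)) as [H|H].
  - rewrite app_nth1 by (rewrite length_map, length_seq; lia).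
    rewrite nth_indep with (d' := snd s (phi 1 0)) by (rewrite length_map, length_seq; lia).
    rewrite (map_nth (fun a => snd s (phi 1 a))), seq_nth by lia. do 2 f_equal. lia.
  - rewrite app_nth2 by (rewrite length_map, length_seq; lia). rewrite length_map, length_seq.
    destruct (Nat.leb_spec a (fst s 21 + m)) as [H'|H'].
    + rewrite nth_indep with (d' := guessed s 0) by (rewrite length_map, length_seq; lia).
      rewrite map_nth, seq_nth by lia. f_equal. lia.
    + apply nth_overflow. rewrite length_map, length_seq. lia.
Qed.

Section OracleSearch.
(* [N] semi-decides the oracle set; its tape is track 2 and its index registers start at
   [bq + 1].  Track 3 holds the guesses.  Registers: 5 number of the query, 6 time bound,
   7 length of the guessed tuple, 8 success flag, 9 program counter of [N], 10 number of
   initialised cells of [N], 11 final value of register 10. *)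
Context (N : machine A) (C bq : nat) (HN : wf_machine A false N)
  (HC : Forall (zbound C) (prog N)) (Hbq : 21 <= bq).

Local Notation O0 := (fun (_ : list U) (_ : U) => False).
Context (O : list U -> U -> Prop).

(** Quantifying over the default [d] avoids choosing an element of the universe; a nonempty list
    determines its last entry by itself. *)
Definition halts_in (L : list U) (t : nat) : Prop :=
  exists p cf d, p <= t /\ nsteps O0 N p (start L d) cf /\ lab cf = length (prog N).

Lemma halts_in_det L : L <> [] -> (halts_det A N L <-> exists t, halts_in L t).
Proof.
  intros HL. unfold halts_det, halts_in, start. destruct L as [|b L]; [easy|]. simpl init_det. split.
  - intros (c0 & cf & -> & Hr & Hf). apply reach_nsteps in Hr as [p Hr].
    exists p, p, cf, b. repeat split; auto.
  - intros (t & p & cf & d & _ & Hr & Hf). exists (start (b :: L) b), cf.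
    split; [reflexivity|]. split; [|easy]. apply reach_nsteps. exists p.
    unfold start. now rewrite (last_default _ b d).
Qed.

(** Registers above [bq] belong to [N] and may change, as may its track 2; [Q] selects the
    bookkeeping registers that survive. *)
Definition qframe (Q : nat -> Prop) (s s' : state) : Prop :=
  (forall q, q <= bq -> Q q -> fst s' q = fst s q) /\
  (forall p, (forall a, p <> phi 2 a) -> snd s' p = snd s p).

Lemma qframe_refl Q s : qframe Q s s.
Proof. now split. Qed.

Lemma qframe_trans (Q Q1 Q2 : nat -> Prop) s1 s2 s3 : (forall q, Q q -> Q1 q /\ Q2 q) ->
  qframe Q1 s1 s2 -> qframe Q2 s2 s3 -> qframe Q s1 s3.
Proof.
  intros HQ [H1 Z1] [H2 Z2]. split.
  - intros q Hq HQq. destruct (HQ q HQq). rewrite H2, H1; auto.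
  - intros p Hp. rewrite Z2, Z1; auto.
Qed.

Lemma qframe_guessed (Q : nat -> Prop) s s' a : Q 1 -> Q 5 -> qframe Q s s' ->
  guessed s' a = guessed s a.
Proof.
  intros H1 H5 [Hq Hz]. unfold guessed. rewrite (Hq 1), (Hq 5), Hz; auto; try lia.
  unfold guess_addr, phi. intros b. lia.
Qed.

Lemma qframe_query (Q : nat -> Prop) s s' m : Q 1 -> Q 5 -> Q 21 -> qframe Q s s' ->
  query s' m = query s m.
Proof.
  intros H1 H5 H21 Hf. unfold query. rewrite (proj1 Hf 21); [|lia|easy]. f_equal.
  - apply map_ext. intros a. apply (proj2 Hf). unfold phi. intros b. lia.
  - apply map_ext. intros a. now apply qframe_guessed with Q.
Qed.

(** * A run of the semi-decision machine with bounded time *)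

Definition setup : cmd :=
  Seq (for_copy (ER 21) (phie 2 (ER 4)) (phie 1 (ER 4)))
  (Seq (for_copy (ER 7) (phie 2 (EAdd (ER 21) (ER 4))) (guess_expr (ER 4)))
  (Seq (for_copy (EC C) (phie 2 (EAdd (EAdd (ER 21) (ER 7)) (ER 4))) (guess_expr (ER 7)))
  (Seq (reset bq (nidx N))
  (Seq (Asg (bq + 1) (EAdd (ER 21) (ER 7)))
  (Seq (Asg 9 (EC 1))
  (Seq (Asg 10 (EAdd (EAdd (ER 21) (ER 7)) (EC C)))
       (Asg 11 (EAdd (ER 10) (ER 6))))))))).

(** Register 10 is frontier and clock at once: each pass simulates at most one step and initialises
    one cell. Once [N] has halted, the remaining passes merely let the clock run out. *)
Definition run : cmd :=
  While (ER 10) (ER 11)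
    (Seq (IfEq (ER 9) (EC (length (prog N))) Skip (sim_step N bq 9 2 (fun _ => Skip)))
      (Seq (Asg 10 (EAdd (ER 10) (EC 1))) (ZCopy (phie 2 (ER 10)) (guess_expr (ER 7))))).

Definition attempt : cmd :=
  Seq setup (Seq run (IfEq (ER 9) (EC (length (prog N))) (Asg 8 (EC 2)) Skip)).

Definition attempt_kept (q : nat) : Prop := q <> 4 /\ q <> 9 /\ q <> 10 /\ q <> 11.

Lemma wp_setup (s : state) d (P : state -> Prop) : 1 <= fst s 21 -> 1 <= fst s 7 ->
  (forall s', qframe attempt_kept s s' ->
     srel N bq 9 2 (fst s' 10) (fst s' 10) (start (query s (fst s 7)) d) s' ->
     fst s' 10 = fst s 21 + fst s 7 + C -> fst s' 11 = fst s' 10 + fst s 6 -> P s') ->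
  wp O setup s P.
Proof.
  intros H21 H7 HP. set (v := fst s 21). set (m := fst s 7).
  apply wp_seq, wp_for_copy with (N := v) (D := phi 2) (S := phi 1).
  { intros i Hi. simpl. rewrite (Hi 21) by lia. unfold phi, v. lia. }
  { unfold phi; intros; lia. }
  { unfold phi; intros; lia. }
  intros s1 Hq1 Hz1 Hf1.
  apply wp_seq, wp_for_copy with (N := m) (D := fun a => phi 2 (v + a))
    (S := guess_addr (fst s 1) (fst s 5)).
  { intros i Hi. rewrite eval_guess_expr. simpl. rewrite (Hi 1), (Hi 5), (Hi 7), (Hi 21), !Hq1 by lia.
    unfold phi, v, m. lia. }
  { unfold phi; intros; lia. }
  { unfold guess_addr, phi; intros; lia. }
  intros s2 Hq2 Hz2 Hf2.
  (* These [C] padding cells bring every fixed register of [N] into the initialised area. *)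
  apply wp_seq, wp_for_copy with (N := C) (D := fun a => phi 2 (v + m + a))
    (S := fun _ => guess_addr (fst s 1) (fst s 5) m).
  { intros i Hi. rewrite eval_guess_expr. simpl. rewrite (Hi 1), (Hi 5), (Hi 7), (Hi 21), !Hq2, !Hq1 by lia.
    unfold phi, v, m. lia. }
  { unfold phi; intros; lia. }
  { unfold guess_addr, phi; intros; lia. }
  intros s3 Hq3 Hz3 Hf3.
  assert (Hi3 : forall q, q <> 4 -> fst s3 q = fst s q)
    by (intros q Hq; now rewrite Hq3, Hq2, Hq1).
  apply wp_seq, wp_reset. intros i4 Hr4 Hq4.
  apply wp_seq, wp_asg, wp_seq, wp_asg, wp_seq, wp_asg, wp_asg. cbn [fst snd eval].
  upds. rewrite !(Hq4 21), !(Hq4 7), !(Hq4 6), !Hi3 by lia. fold v m.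
  apply HP; cbn [fst snd]; upds; auto.
  - split; cbn [fst snd].
    + intros q Hq (Q1 & Q2 & Q3 & Q4). upds. rewrite Hq4, Hi3; auto. lia.
    + intros p Hp. rewrite Hf3, Hf2, Hf1; auto.
  - unfold srel, start. cbn [fst snd mk lab ireg zreg]. upds. split; [easy|]. split.
    + intros j Hj. rewrite query_length. fold v. unfold init_idx.
      destruct (Nat.eqb_spec j 1) as [->|Hj1].
      * upds. lia.
      * upds. rewrite Hr4 by lia. lia.
    + intros a Ha. rewrite query_tape by lia. fold v m. unfold guessed.
      destruct (Nat.leb_spec a v) as [H|H].
      * rewrite Hf3, Hf2, Hz1; auto; unfold phi; intros; lia.
      * destruct (Nat.leb_spec a (v + m)) as [H'|H'].
        -- rewrite Hf3 by (unfold phi; intros; lia).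
           replace (phi 2 a) with (phi 2 (v + (a - v))) by (f_equal; lia).
           rewrite Hz2, Hf1; [easy| |lia]. intros; apply guess_addr_off; lia.
        -- replace (phi 2 a) with (phi 2 (v + m + (a - v - m))) by (f_equal; lia).
           rewrite Hz3, Hf2, Hf1; [easy| | |lia]; intros; apply guess_addr_off; lia.
Qed.

(** The invariant keeps a configuration reached in [p] steps, where [p] is the number of passes
    unless it is final. When the clock has run out, a non-final one shows that no run of at most [t]
    steps halts, because halting configurations are unique. *)
Lemma wp_run (s : state) m d (P : state -> Prop) t : 1 <= m -> fst s 7 = m ->
  srel N bq 9 2 (fst s 10) (fst s 10) (start (query s m) d) s ->
  fst s 21 + m + C <= fst s 10 -> fst s 11 = fst s 10 + t ->
  (forall s', qframe attempt_kept s s' -> (halts_in (query s m) t <-> fst s' 9 = length (prog N)) ->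
     P s') ->
  wp O run s P.
Proof.
  intros Hm H7 Hs H10 H11 HP. set (h0 := fst s 10) in *. set (c0 := start (query s m) d) in *.
  apply wp_while with (n := t) (I := fun n s' =>
    fst s' 10 + n = h0 + t /\ fst s' 11 = h0 + t /\ qframe attempt_kept s s' /\
    exists p c, nsteps O0 N p c0 c /\ h0 + p <= fst s' 10 /\
      (lab c <> length (prog N) -> h0 + p = fst s' 10) /\ 1 <= lab c <= length (prog N) /\
      srel N bq 9 2 (fst s' 10) (fst s' 10) c s' /\
      forall a, fst s' 10 < a -> zreg c a = guessed s m).
  - intros n s' (Hn & H11' & Hfr & p & c & Hp & Hle & Hex & Hl & Hr & Hfar) E.
    unfold evals_eq in E. simpl in E. apply HP; [easy|].
    destruct Hr as (-> & _). split.
    + intros (q & cf & d' & Hq & Hcf & Hf).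
      (* Both start configurations agree: the last entry of the query is the [m]-th guess. *)
      replace (start (query s m) d') with c0 in Hcf.
      2: { unfold c0, start. now rewrite !query_last. }
      destruct (Nat.eq_dec (lab c) (length (prog N))) as [|Hne]; [easy|].
      rewrite (nsteps_halt_unique false N q p c0 cf c HN Hcf Hf Hp); [easy|].
      specialize (Hex Hne). lia.
    + intros Hf. exists p, c, d. repeat split; auto. lia.
  - intros n s' (Hn & H11' & Hfr & p & c & Hp & Hle & Hex & Hl & Hr & Hfar) E.
    unfold evals_eq in E. simpl in E. set (h := fst s' 10) in *.
    (* The tail shared by the idle and the active pass: one more cell receives the padding value. *)
    assert (Hgs : forall s1, qframe attempt_kept s' s1 -> fst s1 10 = h ->
      forall c1 p1, nsteps O0 N p1 c0 c1 -> h0 + p1 <= S h ->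
      (lab c1 <> length (prog N) -> h0 + p1 = S h) -> 1 <= lab c1 <= length (prog N) ->
      srel N bq 9 2 (S h) h c1 s1 -> (forall a, h < a -> zreg c1 a = guessed s m) ->
      fst s1 11 = h0 + t ->
      wp O (Seq (Asg 10 (EAdd (ER 10) (EC 1))) (ZCopy (phie 2 (ER 10)) (guess_expr (ER 7)))) s1
        (fun s2 => exists n', n' < n /\ fst s2 10 + n' = h0 + t /\ fst s2 11 = h0 + t /\
          qframe attempt_kept s s2 /\
          exists p c, nsteps O0 N p c0 c /\ h0 + p <= fst s2 10 /\
            (lab c <> length (prog N) -> h0 + p = fst s2 10) /\ 1 <= lab c <= length (prog N) /\
            srel N bq 9 2 (fst s2 10) (fst s2 10) c s2 /\
            forall a, fst s2 10 < a -> zreg c a = guessed s m)).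
    { intros s1 Hfr1 H10' c1 p1 Hp1 Hle1 Hex1 Hl1 (Hl2 & Hi1 & Hz1) Hfar1 H111.
      assert (Hfr2 : qframe attempt_kept s s1)
        by (apply qframe_trans with attempt_kept attempt_kept s'; auto).
      apply wp_seq, wp_asg, wp_zcopy. rewrite eval_guess_expr. cbn [fst snd eval phie]. upds.
      assert (Hval : snd s1 (guess_addr (fst s1 1) (fst s1 5) (fst s1 7)) = guessed s m).
      { rewrite <- (qframe_guessed attempt_kept s s1 m); auto; try (unfold attempt_kept; lia).
        unfold guessed. do 2 f_equal. rewrite (proj1 Hfr2 7); [easy|lia|unfold attempt_kept; lia]. }
      rewrite Hval, H10'. exists (n - 1). split; [lia|]. split; [lia|]. split; [easy|]. split.
      - split; cbn [fst snd].
        + intros q Hq HQ. rewrite upd_neq by (unfold attempt_kept in HQ; lia).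
          now apply (proj1 Hfr2).
        + intros a Ha. rewrite upd_neq; [now apply (proj2 Hfr2)|].
          intros ->. apply (Ha (h + 1)). unfold phi. lia.
      - exists p1, c1. rewrite !Nat.add_1_r. split; [easy|]. split; [easy|]. split; [easy|].
        split; [easy|]. split; [|intros a Ha; apply Hfar1; lia].
        split; [|split]; cbn [fst snd].
        + now upds.
        + intros j Hj. upds. auto.
        + intros a Ha. destruct (Nat.eq_dec a (S h)) as [->|Hna].
          * replace (phi 2 (S h)) with (4 * S h + 2) by (unfold phi; lia).
            rewrite upd_eq. symmetry. apply Hfar1. lia.
          * rewrite upd_neq by (unfold phi; lia). apply Hz1. lia. }
    apply wp_seq, wp_ifeq; intros Ec; unfold evals_eq in Ec; simpl in Ec.
    + apply wp_skip. apply (Hgs s') with (c1 := c) (p1 := p); auto.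
      * apply qframe_refl.
      * destruct Hr as (Hr1 & Hr2 & Hr3). intros Hne. congruence.
      * destruct Hr as (Hr1 & Hr2 & Hr3). split; [easy|]. split; [|easy].
        intros j Hj. specialize (Hr2 j Hj). lia.
    + assert (Hlab : fst s' 9 = lab c) by apply Hr. rewrite Hlab in Ec.
      destruct (fetch false N (lab c) HN) as (ins & Hnth & Hwi & Hin & Hns); [lia|].
      assert (Ho : ~ is_oracle ins) by (destruct ins; simpl in *; auto; now destruct Hwi).
      destruct (exec_total O0 ins c Hns Ho) as [c1 He].
      assert (Hst : step O0 N c c1) by (split; [lia|]; now exists ins).
      destruct (step_inv false O0 N c c1 HN Hst) as (_ & _ & _ & _ & _ & _ & Hl').
      pose proof HC as HC'. rewrite Forall_forall in HC'.
      destruct (sim_instr_exec N bq 9 2 (fun _ => Skip) false O0 O C h ins c c1 s')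
        as [(s1 & Hd & Hr1 & Hf1) Hz1]; auto; try lia.
      exists s1. split.
      { apply (sim_step_at N bq 9 2 (fun _ => Skip) s' s1 O ins); rewrite ?Hlab; auto. lia. }
      apply (Hgs s1) with (c1 := c1) (p1 := S p); auto.
      * split; [|apply Hf1]. intros q Hq HQ. apply Hf1; unfold attempt_kept in HQ; lia.
      * apply Hf1; lia.
      * now apply nsteps_snoc with c.
      * specialize (Hex Ec). lia.
      * specialize (Hex Ec). lia.
      * intros a Ha. rewrite Hz1 by easy. now apply Hfar.
      * rewrite (proj1 Hf1 11) by lia. easy.
  - split; [easy|]. split; [easy|]. split; [apply qframe_refl|].
    exists 0, c0. split; [easy|]. split; [fold h0; lia|]. split; [fold h0; lia|].
    split; [|split; [exact Hs|]].
    + unfold c0, start. simpl. destruct HN as (_ & (P0 & -> & _) & _). rewrite length_app. simpl. lia.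
    + intros a Ha. unfold c0, start. cbn [mk zreg snd]. rewrite query_tape by lia.
      fold h0 in Ha.
      destruct (Nat.leb_spec a (fst s 21)); [lia|]. destruct (Nat.leb_spec a (fst s 21 + m)); [lia|easy].
Qed.

Lemma wp_attempt (s : state) (P : state -> Prop) : 1 <= fst s 21 -> 1 <= fst s 7 ->
  (forall s', qframe (fun q => attempt_kept q /\ q <> 8) s s' ->
     (halts_in (query s (fst s 7)) (fst s 6) -> fst s' 8 = 2) ->
     (fst s' 8 = fst s 8 \/ halts_in (query s (fst s 7)) (fst s 6)) -> P s') ->
  wp O attempt s P.
Proof.
  intros H21 H7 HP. set (m := fst s 7) in *.
  apply wp_seq, wp_setup with (d := snd s 0); auto.
  intros s1 Hf1 Hs1 H10 H11.
  assert (E7 : fst s1 7 = m) by (apply Hf1; unfold attempt_kept; lia).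
  assert (E21 : fst s1 21 = fst s 21) by (apply Hf1; unfold attempt_kept; lia).
  assert (E : query s1 m = query s m) by
    (apply qframe_query with attempt_kept; auto; unfold attempt_kept; lia).
  fold m in Hs1, H10. rewrite <- E in Hs1.
  apply wp_seq, wp_run with (m := m) (d := snd s 0) (t := fst s 6); auto; [lia|].
  intros s2 Hf2 Hh. rewrite E in Hh.
  assert (Hf : qframe attempt_kept s s2)
    by (apply qframe_trans with attempt_kept attempt_kept s1; auto).
  assert (E8 : fst s2 8 = fst s 8) by (apply Hf; unfold attempt_kept; lia).
  apply wp_ifeq; intros Ec; unfold evals_eq in Ec; simpl in Ec.
  - apply wp_asg. apply HP; cbn [fst snd eval].
    + split; cbn [fst snd]; [|apply Hf]. intros q Hq [HQ HQ8]. rewrite upd_neq by easy. now apply Hf.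
    + intros _. now upds.
    + right. now apply Hh.
  - apply wp_skip. apply HP; auto.
    + split; [|apply Hf]. intros q Hq [HQ _]. now apply Hf.
    + intros Hc. apply Hh in Hc. contradiction.
Qed.

(** * Dovetailing over witness lengths and running times *)

Definition for_lengths : cmd :=
  Seq (Asg 7 (EC 1))
    (While (ER 7) (EAdd (ER 6) (EC 1)) (Seq attempt (Asg 7 (EAdd (ER 7) (EC 1))))).

Definition search : cmd :=
  Seq (Asg 6 (EC 1)) (Seq (Asg 8 (EC 1))
    (While (ER 8) (EC 2) (Seq for_lengths (Asg 6 (EAdd (ER 6) (EC 1)))))).

Definition search_kept (q : nat) : Prop := q <= 3 \/ q = 5 \/ 12 <= q.

Lemma wp_for_lengths (s : state) (P : state -> Prop) : 1 <= fst s 21 -> 1 <= fst s 6 ->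
  (forall s', qframe search_kept s s' -> fst s' 6 = fst s 6 ->
     (forall m, 1 <= m <= fst s 6 -> halts_in (query s m) (fst s 6) -> fst s' 8 = 2) ->
     (fst s' 8 = fst s 8 \/ exists m, 1 <= m /\ halts_in (query s m) (fst s 6)) -> P s') ->
  wp O for_lengths s P.
Proof.
  intros H21 H6 HP. set (t := fst s 6) in *. apply wp_seq, wp_asg.
  apply wp_while with (n := t) (I := fun n s' =>
    1 <= fst s' 7 /\ fst s' 7 + n = t + 1 /\ qframe search_kept s s' /\ fst s' 6 = t /\
    (forall m, 1 <= m < fst s' 7 -> halts_in (query s m) t -> fst s' 8 = 2) /\
    (fst s' 8 = fst s 8 \/ exists m, 1 <= m /\ halts_in (query s m) t)).
  - intros n s' (H7 & Hn & Hf & H6' & Hc & Hs) E. unfold evals_eq in E. simpl in E.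
    apply HP; auto. intros m Hm. apply Hc. lia.
  - intros n s' (H7 & Hn & Hf & H6' & Hc & Hs) E. unfold evals_eq in E. simpl in E.
    assert (E21 : fst s' 21 = fst s 21) by (apply Hf; unfold search_kept; lia).
    assert (Eq : forall m, query s' m = query s m) by
      (intros m; apply qframe_query with search_kept; auto; unfold search_kept; lia).
    apply wp_seq, wp_attempt; [lia|easy|]. intros s1 Hf1 Hh Hs1. rewrite Eq, H6' in Hh, Hs1.
    assert (E6 : fst s1 6 = t) by (rewrite <- H6'; apply Hf1; unfold attempt_kept; lia).
    assert (E7 : fst s1 7 = fst s' 7) by (apply Hf1; unfold attempt_kept; lia).
    apply wp_asg. exists (n - 1). cbn [fst snd eval]. upds. rewrite E7.
    split; [lia|]. split; [lia|]. split; [lia|]. split; [|split; [easy|split]].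
    + apply qframe_trans with search_kept search_kept s'; auto. split; [|apply Hf1].
      cbn [fst snd]. intros q Hq HQ. unfold search_kept in HQ. rewrite upd_neq by lia.
      apply Hf1; [easy|]. unfold attempt_kept. lia.
    + intros m Hm Hm2. destruct (Nat.eq_dec m (fst s' 7)) as [->|Hne]; [auto|].
      destruct Hs1 as [->|Hs1]; [apply Hc with m; auto; lia|auto].
    + destruct Hs1 as [->|Hs1]; [easy|]. right. eauto.
  - cbn [fst snd eval]. upds. split; [lia|]. split; [lia|]. split; [|split; [easy|split; [intros; lia|now left]]].
    split; [|easy]. cbn [fst snd]. intros q Hq HQ. unfold search_kept in HQ. now upds.
Qed.

Lemma halts_in_mono L t t' : t <= t' -> halts_in L t -> halts_in L t'.
Proof. intros Ht (p & cf & d & Hp & H). exists p, cf, d. split; [lia|easy]. Qed.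

(** The round with time bound [m + t] tries the length [m] and allows at least [t] steps, so the
    search ends by then. Another prefix may be accepted earlier; this is harmless, as all prefixes
    share the first element, which is the answer. *)
Lemma wp_search (s : state) (P : state -> Prop) m t : 1 <= fst s 21 -> 1 <= m ->
  halts_in (query s m) t -> (forall s', qframe search_kept s s' -> P s') ->
  wp O search s P.
Proof.
  intros H21 Hm Hh HP. apply wp_seq, wp_asg, wp_seq, wp_asg. cbn [fst snd eval].
  apply wp_while with (n := m + t) (I := fun n s' => 1 <= fst s' 6 /\
    (fst s' 8 = 2 \/ 1 <= n /\ fst s' 6 + n = m + t + 1) /\ qframe search_kept s s').
  - intros n s' (_ & _ & Hf) _. auto.
  - intros n s' (H6 & Hn & Hf) E. unfold evals_eq in E. simpl in E.
    assert (E21 : fst s' 21 = fst s 21) by (apply Hf; unfold search_kept; lia).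
    assert (Eq : forall m, query s' m = query s m) by
      (intros k; apply qframe_query with search_kept; auto; unfold search_kept; lia).
    apply wp_seq, wp_for_lengths; [lia|easy|]. intros s1 Hf1 H61 Hc _. apply wp_asg.
    cbn [fst snd eval]. destruct Hn as [|Hn]; [contradiction|].
    exists (n - 1). upds. rewrite H61. split; [lia|]. split; [lia|]. split.
    + destruct (Nat.eq_dec (fst s' 6) (m + t)) as [E6|E6]; [left|right; lia].
      apply (Hc m); [lia|]. rewrite Eq. apply halts_in_mono with t; [lia|easy].
    + apply qframe_trans with search_kept search_kept s'; auto. split; [|apply Hf1].
      cbn [fst snd]. intros q Hq HQ. unfold search_kept in HQ. rewrite upd_neq by lia.
      now apply Hf1.
  - cbn [fst snd]. upds. split; [lia|]. split; [right; lia|]. split; [|easy].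
    cbn [fst snd]. intros q Hq HQ. unfold search_kept in HQ. now upds.
Qed.

Lemma reset_oracle_free b K : oracle_free_cmd (reset b K).
Proof. induction K; simpl; auto. Qed.

Lemma for_lengths_oracle_free : oracle_free_cmd for_lengths.
Proof.
  assert (H1 := reset_oracle_free bq (nidx N)).
  assert (H2 : oracle_free_cmd (sim_step N bq 9 2 (fun _ => Skip))).
  { now apply sim_step_oracle_free. }
  simpl. tauto.
Qed.

Lemma search_oracle_free : oracle_free_cmd search.
Proof. pose proof for_lengths_oracle_free. simpl. tauto. Qed.

(** The outer loop may diverge, so it is treated by an invariant; each of its rounds terminates, and
    total correctness applies there. *)
Lemma search_sound s s' : 1 <= fst s 21 -> den O search s s' ->
  exists m t, 1 <= m /\ halts_in (query s m) t.
Proof.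
  intros H21 (s1 & -> & s2 & -> & Hd).
  apply while_inv with (I := fun s' => 1 <= fst s' 6 /\ qframe search_kept s s' /\
    (fst s' 8 = 1 \/ exists m t, 1 <= m /\ halts_in (query s m) t)) in Hd as [(_ & _ & H) E].
  - destruct H as [H|H]; [|easy]. unfold evals_eq in E. simpl in E. congruence.
  - clear s' Hd. intros s1 s2 (H6 & Hf & Hh) _ (s3 & Hd3 & ->). cbn [fst snd eval].
    assert (E21 : fst s1 21 = fst s 21) by (apply Hf; unfold search_kept; lia).
    assert (Eq : forall m, query s1 m = query s m) by
      (intros k; apply qframe_query with search_kept; auto; unfold search_kept; lia).
    destruct (wp_den O for_lengths s1 (fun s' => qframe search_kept s1 s' /\ fst s' 6 = fst s1 6 /\
      (fst s' 8 = fst s1 8 \/ exists m, 1 <= m /\ halts_in (query s1 m) (fst s1 6))) s3)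
      as (Hf3 & H63 & Hh3); auto.
    { apply for_lengths_oracle_free. }
    { apply wp_for_lengths; auto. lia. }
    upds. split; [lia|]. split.
    + apply qframe_trans with search_kept search_kept s1; auto. split; [|apply Hf3].
      cbn [fst snd]. intros q Hq HQ. unfold search_kept in HQ. rewrite upd_neq by lia.
      now apply Hf3.
    + destruct Hh3 as [->|(m & Hm & Hm2)]; [easy|]. right. rewrite Eq in Hm2. eauto.
  - cbn [fst snd]. upds. split; [simpl; lia|]. split; [|now left]. split; [|easy].
    cbn [fst snd]. intros q Hq HQ. unfold search_kept in HQ. now upds.
Qed.
End OracleSearch.

(** * Simulation of oracle machines by non-deterministic machines *)

Section OracleByGuess.
Context (M : machine A) (CM : nat) (HM : wf_machine A true M)
  (HCM : Forall (zbound CM) (prog M)).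
Context (N : machine A) (CN : nat) (HN : wf_machine A false N)
  (HCN : Forall (zbound CN) (prog N)).
Context (Q : list U -> Prop) (HQ : forall x, Q x <-> halts_det A N x).

Local Notation O0 := (fun (_ : list U) (_ : U) => False).

(** Incrementing register 5 assigns a fresh stream to the next query, so successive answers are
    guessed independently. *)
Definition answer (j : nat) : cmd :=
  Seq (search N CN (20 + nidx M))
    (Seq (ZCopy (EC (phi 1 j)) (guess_expr (EC 1))) (Seq (Asg 5 (EAdd (ER 5) (EC 1))) (incpc 2))).

Definition pad_next : cmd :=
  Seq (Asg 3 (EAdd (ER 3) (EC 1))) (ZCopy (phie 1 (ER 3)) (EC 8)).

Definition query_step : cmd := Seq (sim_step M 20 2 1 answer) pad_next.

Definition pad : cmd :=
  Seq (for_copy (EC CM) (phie 1 (EAdd (ER 3) (ER 4))) (EC 8)) (Asg 3 (EAdd (ER 3) (EC CM))).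

Definition query_prog : cmd :=
  Seq load (Seq pad (Seq (While (ER 2) (EC (length (prog M))) query_step) unload)).

(** The last clause describes the deterministic start: every cell beyond the frontier still holds
    the last input, which [Z_8] remembers. *)
Definition qrel (c : config A) (s : state) : Prop :=
  srel M 20 2 1 (fst s 3) (fst s 3) c s /\ CM <= fst s 3 /\ 1 <= lab c <= length (prog M) /\
  (forall a, fst s 3 < a -> zreg c a = snd s 8).

Definition kept (s s' : state) : Prop :=
  fst s' 1 = fst s 1 /\ fst s' 3 = fst s 3 /\ snd s' 8 = snd s 8 /\
  (forall b, snd s' (phi 3 b) = snd s (phi 3 b)).

Lemma pad_next_qrel c s s1 : kept s s1 -> CM <= fst s 3 ->
  srel M 20 2 1 (S (fst s 3)) (fst s 3) c s1 -> 1 <= lab c <= length (prog M) ->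
  (forall a, fst s 3 < a -> zreg c a = snd s 8) ->
  wp O0 pad_next s1 (fun s' => qrel c s' /\ fst s' 1 = fst s 1 /\ fst s' 5 = fst s1 5 /\
    forall b, snd s' (phi 3 b) = snd s (phi 3 b)).
Proof.
  intros (K1 & K3 & K8 & KG) HC (Hl & Hi & Hz) Hlc Hfar.
  apply wp_seq, wp_asg, wp_zcopy. cbn [fst snd eval phie]. upds.
  rewrite K3, K8, Nat.add_1_r. change (4 * S (fst s 3) + 1) with (phi 1 (S (fst s 3))).
  split; [|split; [easy|split; [easy|]]].
  - unfold qrel, srel. cbn [fst snd]. upds. split; [split; [easy|split]|].
    + intros j Hj. upds. auto.
    + intros a Ha. destruct (Nat.eq_dec a (S (fst s 3))) as [->|Hn].
      * rewrite upd_eq. symmetry. apply Hfar. lia.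
      * rewrite upd_neq by (unfold phi; lia). apply Hz. lia.
    + split; [lia|]. split; [easy|]. intros a Ha. rewrite upd_neq by (unfold phi; lia).
      rewrite K8. apply Hfar. lia.
  - intros b. rewrite upd_neq by (unfold phi; lia). apply KG.
Qed.

Lemma query_out c s m : qrel c s -> query s m = out c ++ map (guessed s) (seq 1 m).
Proof.
  intros ((_ & Hi & Hz) & _). unfold query. f_equal. unfold out.
  destruct (Hi 1) as [E1 Hb1]; [destruct HM; lia|]. simpl in E1. rewrite E1.
  apply map_ext_in. intros a Ha. apply in_seq in Ha. apply Hz. lia.
Qed.

Lemma query_nonempty s m : 1 <= m -> query s m <> [].
Proof. intros Hm E. pose proof (query_length s m) as H. rewrite E in H. simpl in H. lia. Qed.

Lemma wp_answer c s j m : qrel c s -> 1 <= j <= CM -> 1 <= m -> Q (query s m) ->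
  wp O0 (answer j) s (fun s1 => kept s s1 /\ fst s1 5 = S (fst s 5) /\
    srel M 20 2 1 (S (fst s 3)) (fst s 3)
      (mk (S (lab c)) (ireg c, upd (zreg c) j (guessed s 1))) s1).
Proof.
  intros Hr Hj Hm Hq. pose proof Hr as ((Hl & Hi & Hz) & HC & Hlc & Hfar).
  apply HQ, halts_in_det in Hq as [t Ht]; [|now apply query_nonempty].
  assert (H21 : 1 <= fst s 21).
  { destruct (Hi 1) as [E1 Hb1]; [destruct HM; lia|]. simpl in E1. lia. }
  apply wp_seq, wp_search with (m := m) (t := t); auto.
  { destruct HM. lia. }
  intros s1 Hf. assert (HK : forall q, q <= 20 + nidx M -> search_kept q -> fst s1 q = fst s q) by apply Hf.
  assert (HZ : forall p, (forall a, p <> phi 2 a) -> snd s1 p = snd s p) by apply Hf.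
  apply wp_seq, wp_zcopy, wp_seq, wp_asg, wp_asg. rewrite eval_guess_expr.
  cbn [fst snd eval]. upds.
  rewrite (HK 1), (HK 5), (HK 2) by (unfold search_kept; lia).
  rewrite (HZ (guess_addr _ _ _)) by (intros a; apply guess_addr_off; lia).
  fold (guessed s 1). split; [split; [|split; [|split]]|split].
  - cbn [fst snd]. upds. apply HK; unfold search_kept; lia.
  - cbn [fst snd]. upds. apply HK; unfold search_kept; lia.
  - cbn [fst snd]. rewrite upd_neq by (unfold phi; lia). apply HZ. unfold phi; intros; lia.
  - intros b. cbn [fst snd]. rewrite upd_neq by (unfold phi; lia). apply HZ. unfold phi; intros; lia.
  - cbn [fst snd]. upds. lia.
  - unfold srel. cbn [fst snd mk lab ireg zreg]. upds. split; [lia|]. split.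
    + intros k Hk. upds. rewrite HK by (unfold search_kept; lia).
      destruct (Hi k Hk). split; [easy|lia].
    + intros a Ha. destruct (Nat.eq_dec a j) as [->|Hn].
      * now rewrite !upd_eq.
      * rewrite !upd_neq by (unfold phi; lia). rewrite HZ by (unfold phi; intros; lia). now apply Hz.
Qed.

Lemma query_step_plain c s ins c' O : qrel c s -> nth_error (prog M) (lab c - 1) = Some ins ->
  ~ is_oracle ins -> exec O ins c c' -> 1 <= lab c' <= length (prog M) ->
  wp O0 query_step s (fun s' => qrel c' s' /\ fst s' 1 = fst s 1 /\ fst s' 5 = fst s 5 /\
    forall b, snd s' (phi 3 b) = snd s (phi 3 b)).
Proof.
  intros (Hs & HC & Hlc & Hfar) Hn Ho He Hl'. pose proof (nth_error_In _ _ Hn) as Hin.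
  assert (Hwi : wf_instr A true M ins) by (now apply (proj2 (proj2 HM))).
  pose proof HCM as HC'. rewrite Forall_forall in HC'.
  destruct (sim_instr_exec M 20 2 1 answer true O O0 CM (fst s 3) ins c c' s)
    as [(s1 & Hd & Hr & Hf) Hz]; auto; try lia.
  apply wp_seq. exists s1. split.
  { apply (sim_step_at M 20 2 1 answer s s1 O0 ins); auto; destruct Hs as (-> & _ & _); auto. lia. }
  assert (E5 : fst s1 5 = fst s 5) by (apply Hf; lia). rewrite <- E5.
  apply pad_next_qrel; auto.
  - split; [|split; [|split]]; try (apply Hf; lia).
    + apply Hf. unfold phi; intros; lia.
    + intros b. apply Hf. unfold phi; intros; lia.
  - intros a Ha. rewrite Hz by easy. now apply Hfar.
Qed.

Lemma query_step_oracle c s j m : qrel c s ->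
  nth_error (prog M) (lab c - 1) = Some (IOracle j) -> 1 <= m -> Q (query s m) ->
  lab c < length (prog M) ->
  wp O0 query_step s (fun s' =>
    qrel (mk (S (lab c)) (ireg c, upd (zreg c) j (guessed s 1))) s' /\
    fst s' 1 = fst s 1 /\ fst s' 5 = S (fst s 5) /\
    forall b, snd s' (phi 3 b) = snd s (phi 3 b)).
Proof.
  intros Hr Hn Hm Hq Hl. pose proof Hr as (Hs & HC & Hlc & Hfar).
  pose proof (nth_error_In _ _ Hn) as Hin.
  destruct (proj2 (proj2 HM) _ Hin) as [_ Hwi]. unfold wf_zreg in Hwi.
  pose proof HCM as HC'. rewrite Forall_forall in HC'. specialize (HC' _ Hin). simpl in HC'.
  destruct (wp_answer c s j m Hr) as (s1 & Hd & Hk & H5 & Hr1); auto.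
  apply wp_seq. exists s1. split.
  { apply (sim_step_at M 20 2 1 answer s s1 O0 (IOracle j)); auto; destruct Hs as (-> & _ & _); auto. lia. }
  rewrite <- H5. apply pad_next_qrel; auto.
  - cbn [mk lab]. lia.
  - intros a Ha. cbn [mk zreg snd]. rewrite upd_neq by lia. now apply Hfar.
Qed.

Lemma query_step_oracle_free : oracle_free_cmd query_step.
Proof.
  split; [|simpl; tauto]. apply sim_step_oracle_free. intros j _.
  pose proof (search_oracle_free N CN (20 + nidx M)). simpl in *. tauto.
Qed.

(** The cases differ in whether a guess stream is consumed. In the second, [G] prescribes the
    contents of that stream, and it depends on the step alone, not on the simulating state. *)
Lemma query_step_complete c c' : step (nuQ A Q) M c c' ->
  (forall s, qrel c s -> wp O0 query_step s (fun s' => qrel c' s' /\ fst s' 1 = fst s 1 /\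
     fst s' 5 = fst s 5 /\ forall b, snd s' (phi 3 b) = snd s (phi 3 b))) \/
  (exists G, forall s, qrel c s -> (forall a, 1 <= a -> guessed s a = G a) ->
     wp O0 query_step s (fun s' => qrel c' s' /\ fst s' 1 = fst s 1 /\
     fst s' 5 = S (fst s 5) /\ forall b, snd s' (phi 3 b) = snd s (phi 3 b))).
Proof.
  intros Hs. destruct (step_inv true _ M c c' HM Hs) as (ins & Hn & Hwi & Hin & He & Hl & Hl').
  destruct (classic (is_oracle ins)) as [Ho|Ho].
  - right. destruct ins; try contradiction. apply exec_inv in He.
    destruct He as (s1 & (y & (rest & Hq) & ->) & ->).
    (* The stream begins with the answer and the rest of its witness; continuing it by [y] is an
       arbitrary choice. *)
    exists (fun a => nth (a - 1) (y :: rest) y). intros s Hr HG.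
    assert (Em : map (guessed s) (seq 1 (S (length rest))) = y :: rest).
    { apply nth_ext with (d := guessed s 0) (d' := y); rewrite length_map, length_seq; [easy|].
      intros n Hlt. rewrite map_nth, seq_nth, HG by lia. f_equal. lia. }
    assert (Ey : guessed s 1 = y) by (rewrite HG by lia; reflexivity).
    assert (Hq' : Q (query s (S (length rest)))) by (rewrite (query_out c s _ Hr), Em; exact Hq).
    pose proof (query_step_oracle c s j (S (length rest)) Hr Hn ltac:(lia) Hq' ltac:(lia)) as H.
    rewrite Ey in H. exact H.
  - left. intros s Hr. now apply (query_step_plain c s ins c' (nuQ A Q)).
Qed.

(** At an oracle instruction the finished search supplies an accepted prefix. This prefix makes the
    answer legitimate and also feeds the total-correctness lemma, whose outcome is the given one by
    determinism. *)
Lemma query_step_sound c s s' : qrel c s -> fst s 2 <> length (prog M) ->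
  den O0 query_step s s' -> exists c', step (nuQ A Q) M c c' /\ qrel c' s'.
Proof.
  intros Hr Hne Hd. pose proof Hr as ((Hl & Hi & Hz) & HC & Hlc & Hfar).
  destruct (fetch true M (lab c) HM) as (ins & Hn & Hwi & Hin & Hns); [lia|].
  destruct (classic (is_oracle ins)) as [Ho|Ho].
  - destruct ins; try contradiction.
    assert (H21 : 1 <= fst s 21).
    { destruct (Hi 1) as [E1 Hb1]; [destruct HM; lia|]. simpl in E1. lia. }
    assert (exists m, 1 <= m /\ Q (query s m)) as (m & Hm & Hq).
    { destruct Hd as (s1 & Hd & _).
      apply (sim_step_at M 20 2 1 answer s s1 O0 (IOracle j)) in Hd; rewrite ?Hl; auto; [|lia].
      destruct Hd as (s2 & Hd & _). apply search_sound in Hd as (m & t & Hm & Ht); auto; [|destruct HM; lia].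
      exists m. split; [easy|]. apply HQ, halts_in_det; [now apply query_nonempty|eauto]. }
    exists (mk (S (lab c)) (ireg c, upd (zreg c) j (guessed s 1))).
    split; [|apply (wp_den _ _ _ _ _ query_step_oracle_free
      (query_step_oracle c s j m Hr Hn Hm Hq ltac:(lia)) Hd)].
    split; [lia|]. exists (IOracle j). split; [easy|].
    apply exec_atom. exists (guessed s 1). split; [|reflexivity].
    (* The first guess is the answer; the other guesses of the accepted prefix complete its
       witness. *)
    destruct m as [|m]; [lia|]. exists (map (guessed s) (seq 2 m)).
    rewrite (query_out c s _ Hr) in Hq. exact Hq.
  - destruct (exec_total (nuQ A Q) ins c Hns Ho) as [c' He].
    assert (Hs : step (nuQ A Q) M c c') by (split; [lia|]; now exists ins).
    destruct (step_inv true _ M c c' HM Hs) as (_ & _ & _ & _ & _ & _ & Hl').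
    exists c'. split; [easy|].
    apply (wp_den _ _ _ _ _ query_step_oracle_free
      (query_step_plain c s ins c' (nuQ A Q) Hr Hn Ho He Hl') Hd).
Qed.

(** The streams are collected backwards along the run. Generalising over [k0], the number of the
    next query, lets an oracle step put its own stream in front of those for the remaining run. *)
Lemma query_loop_complete c c' : reach (nuQ A Q) M c c' -> lab c' = length (prog M) ->
  forall k0, exists G, forall s, qrel c s -> fst s 5 = k0 ->
    (forall k a, k0 <= k -> 1 <= a -> snd s (guess_addr (fst s 1) k a) = G k a) ->
    wp O0 (While (ER 2) (EC (length (prog M))) query_step) s (fun s' => qrel c' s').
Proof.
  intros Hr Hf. apply clos_rt_rt1n in Hr.
  induction Hr as [c|c c1 c' Hs _ IH]; intros k0.
  - exists (fun _ _ => zreg c 0). intros s Hq _ _. exists s. split; [|easy]. split; [constructor|].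
    unfold evals_eq; simpl. destruct Hq as ((-> & _) & _). easy.
  - assert (Hloop : forall s, qrel c s ->
      wp O0 query_step s (fun s1 => wp O0 (While (ER 2) (EC (length (prog M))) query_step) s1
        (fun s' => qrel c' s')) ->
      wp O0 (While (ER 2) (EC (length (prog M))) query_step) s (fun s' => qrel c' s')).
    { intros s ((Hl & _) & _) (s1 & Hd & s2 & [Hd2 Ht] & Hq). exists s2. split; [|easy].
      split; [|easy]. econstructor; [|exact Hd2]. split; [|easy].
      unfold evals_eq; simpl. destruct (step_inv true _ M c c1 HM Hs) as (_ & _ & _ & _ & _ & H & _). lia. }
    destruct (query_step_complete c c1 Hs) as [H|[G0 H]].
    + destruct (IH Hf k0) as [G HG]. exists G. intros s Hq H5 Hg. apply Hloop; [easy|].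
      eapply wp_mono; [now apply H|]. intros s1 (Hq1 & E1 & E5 & E3). apply HG; auto; [lia|].
      intros k a Hk Ha. rewrite E1. unfold guess_addr. rewrite E3. now apply Hg.
    + destruct (IH Hf (S k0)) as [G HG].
      (* Stream [k0] serves this query; the rest of the run reads later streams only. *)
      exists (fun k => if Nat.eqb k k0 then G0 else G k). intros s Hq H5 Hg. apply Hloop; [easy|].
      eapply wp_mono; [apply H; [easy|]|].
      * intros a Ha. unfold guessed. rewrite H5, Hg by lia. now rewrite Nat.eqb_refl.
      * intros s1 (Hq1 & E1 & E5 & E3). apply HG; auto; [lia|].
        intros k a Hk Ha. rewrite E1. unfold guess_addr. rewrite E3.
        change (snd s (guess_addr (fst s 1) k a) = G k a). rewrite Hg by lia.
        destruct (Nat.eqb_spec k k0); [lia|easy].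
Qed.

Lemma query_loop_sound c s s' : qrel c s ->
  den O0 (While (ER 2) (EC (length (prog M))) query_step) s s' ->
  exists c', reach (nuQ A Q) M c c' /\ qrel c' s' /\ lab c' = length (prog M).
Proof.
  intros Hq [Hd Ht]. unfold evals_eq in Ht. simpl in Ht. revert c Hq.
  induction Hd as [s|s s1 s' [Hne Hd] _ IH]; intros c Hq.
  - exists c. split; [apply rt_refl|]. split; [easy|]. destruct Hq as ((<- & _) & _). easy.
  - destruct (query_step_sound c s s1 Hq Hne Hd) as (c1 & Hs & Hq1).
    destruct (IH Ht c1 Hq1) as (c' & Hr & H). exists c'. split; [|easy].
    apply rt_trans with c1; [now apply rt_step|easy].
Qed.
End OracleByGuess.

(** * Correctness of the two simulations *)

Lemma init_tape_fill b x' : let x := b :: x' in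
  init_tape x (fill A x (last x b)).
Proof.
  intros x. split; [discriminate|]. intros a Ha. unfold fill. apply nth_error_nth'. lia.
Qed.

Lemma fill_tail b x' g a : let x := b :: x' in
  init_tape x g -> length x < a -> fill A x (last x b) a = g (length x).
Proof.
  intros x [_ Hg] Ha. unfold fill. rewrite nth_overflow by lia.
  assert (Hn : 1 <= length x) by (simpl; lia). specialize (Hg (length x) ltac:(lia)).
  destruct (exists_last (l := x)) as (l & e & E); [discriminate|].
  rewrite E, last_last in *. rewrite length_app in *. simpl in Hg |- *.
  rewrite nth_error_app2 in Hg by lia.
  replace (length l + 1 - 1 - length l) with 0 in Hg by lia. now injection Hg.
Qed.

(* Inverts [guess_addr n k a] for [k, a >= 1]: the square root recovers [k + a]. *)
Definition guess_tape (n : nat) (G : nat -> nat -> U) (p : nat) : U :=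
  let q := (p - 3) / 4 - 2 * n in
  let r := Nat.sqrt q in
  G (r - (q - r * r)) (q - r * r).

Lemma guess_tape_addr n G k a : 1 <= k -> 1 <= a -> guess_tape n G (guess_addr n k a) = G k a.
Proof.
  intros Hk Ha. unfold guess_tape, guess_addr, phi.
  set (t := (k + a) * (k + a)).
  replace (4 * (2 * n + t + a) + 3 - 3) with ((2 * n + t + a) * 4) by lia.
  rewrite Nat.div_mul by lia. replace (2 * n + t + a - 2 * n) with (t + a) by lia.
  rewrite (Nat.sqrt_unique (t + a) (k + a)) by (unfold t; nia). fold t.
  f_equal; lia.
Qed.

Section Correctness.
Context (M : machine A) (CM : nat) (HM : wf_machine A true M)
  (HCM : Forall (zbound CM) (prog M)).
Context (N : machine A) (CN : nat) (HN : wf_machine A false N)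
  (HCN : Forall (zbound CN) (prog N)).
Context (Q : list U -> Prop) (HQ : forall x, Q x <-> halts_det A N x).
Local Notation O0 := (fun (_ : list U) (_ : U) => False).

(** The guessed tape and the deterministic one share the input; loading and padding build the latter
    on track 1 and leave the guess area intact. *)
Lemma wp_load_pad b x' g (P : state -> Prop) : let x := b :: x' in
  init_tape x g ->
  (forall s, qrel M CM (mk 1 (init_idx (length x), fill A x (last x b))) s ->
     fst s 1 = length x -> fst s 5 = 1 ->
     (forall k a, 1 <= k -> 1 <= a -> snd s (guess_addr (length x) k a) = g (guess_addr (length x) k a)) ->
     P s) ->
  wp O0 load (init_idx (length x), g) (fun s1 => wp O0 (pad CM) s1 P).
Proof.
  intros x Hg HP. assert (Hn : 1 <= length x) by (simpl; lia).
  remember (length x) as n eqn:En.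
  apply wp_load; [easy|]. intros s1 Hq1 Hz1 H81 Hf1.
  assert (E3 : fst s1 3 = n) by (now rewrite Hq1).
  apply wp_seq, wp_for_copy with (N := CM) (D := fun a => phi 1 (n + a)) (S := fun _ => 8).
  { intros i Hi. cbn [eval phie]. rewrite (Hi 3), E3 by lia. unfold phi. lia. }
  { unfold phi; intros; lia. }
  { unfold phi; intros; lia. }
  intros s2 Hq2 Hz2 Hf2. apply wp_asg. cbn [eval].
  assert (Hi2 : forall q, q <> 3 -> q <> 4 -> upd (fst s2) 3 (fst s2 3 + CM) q =
    if orb (Nat.eqb q 1) (orb (Nat.eqb q 3) (Nat.eqb q 21)) then n else 1).
  { intros q H3 H4. rewrite upd_neq by easy. now rewrite Hq2, Hq1. }
  apply HP.
  - unfold qrel, srel. cbn [fst snd mk lab ireg zreg]. rewrite !upd_eq, !(Hq2 3), E3 by lia.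
    split; [split; [|split]|split; [lia|split]].
    + rewrite upd_neq, Hq2, Hq1 by lia. reflexivity.
    + intros j Hj. rewrite upd_neq, Hq2, Hq1 by lia. unfold init_idx.
      destruct (Nat.eqb_spec j 1) as [->|Hj1]; [simpl; lia|].
      rewrite !(proj2 (Nat.eqb_neq (20 + j) _)) by lia. simpl. lia.
    + intros a Ha. destruct (le_lt_dec a n) as [H|H].
      * rewrite Hf2 by (unfold phi; intros; lia). rewrite Hz1 by lia.
        destruct (init_tape_fill b x') as [_ Hfill], Hg as [_ Hg].
        fold x in Hfill. specialize (Hg a ltac:(lia)). specialize (Hfill a ltac:(lia)).
        rewrite Hfill in Hg. now injection Hg.
      * replace a with (n + (a - n)) at 1 by lia. rewrite Hz2, H81 by lia.
        symmetry. rewrite En. apply fill_tail; [easy|fold x; lia].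
    + destruct HM as (_ & (P0 & -> & _) & _). rewrite length_app. simpl. lia.
    + intros a Ha. rewrite Hf2 by (unfold phi; intros; lia). rewrite H81.
      rewrite En. apply fill_tail; [easy|fold x; lia].
  - cbn [fst snd]. now rewrite Hi2 by lia.
  - cbn [fst snd]. now rewrite Hi2 by lia.
  - intros k a Hk Ha. cbn [snd]. rewrite Hf2 by (intros; apply guess_addr_off; lia).
    apply Hf1.
    (* For [k] and [a] at least 1 the address is at least [8 * n + 23], beyond the work area of
       [load]. *)
    + unfold guess_addr, phi. nia.
    + unfold guess_addr, phi. generalize (2 * n + (k + a) * (k + a) + a). intros; lia.
Qed.

Lemma query_unload_out c s : qrel M CM c s ->
  map (fun a => snd s (phi 1 a)) (seq 1 (fst s 21)) = out c.
Proof.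
  intros Hq. pose proof (query_out M CM HM c s 0 Hq) as E.
  unfold query in E. simpl in E. now rewrite !app_nil_r in E.
Qed.

Lemma query_prog_correct x y :
  (exists g s', init_tape x g /\ den O0 (query_prog M CM N CN) (init_idx (length x), g) s' /\
     y = out (mk 0 s')) <-> Res_nu A Q M x y.
Proof.
  split.
  - intros (g & s' & Hg & (s1 & Hd1 & s2 & Hd2 & s3 & Hd3 & Hd4) & ->).
    destruct x as [|b x']; [now destruct Hg|]. set (x := b :: x') in *.
    set (c0 := mk 1 (init_idx (length x), fill A x (last x b))).
    assert (Hq : qrel M CM c0 s2).
    { assert (H : wp O0 load (init_idx (length x), g) (fun s1 => wp O0 (pad CM) s1 (qrel M CM c0))).
      { apply wp_load_pad; auto. }
      apply (wp_den O0 load _ _ s1 load_oracle_free H) in Hd1.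
      apply (wp_den O0 (pad CM) s1 _ s2) in Hd1; auto. simpl. tauto. }
    destruct (query_loop_sound M CM HM HCM N CN HN HCN Q HQ c0 s2 s3 Hq Hd3) as (cf & Hr & Hqf & Hf).
    exists c0, cf. repeat split; auto. rewrite <- (query_unload_out cf s3 Hqf).
    apply (wp_den O0 unload s3 _ s' unload_oracle_free (wp_unload O0 s3) Hd4).
  - intros (c0 & cf & Hi & Hr & Hf & ->). unfold init_det in Hi.
    destruct x as [|b x']; [easy|]. set (x := b :: x') in *.
    change (c0 = mk 1 (init_idx (length x), fill A x (last x b))) in Hi. subst c0.
    destruct (query_loop_complete M CM HM HCM N CN HN HCN Q HQ _ cf Hr Hf 1) as [G HG].
    (* The tape to be guessed: the input in front, then all streams laid out at their addresses. *)
    set (g := fun p => if p <=? length x then fill A x (last x b) p else guess_tape (length x) G p).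
    assert (Hg : init_tape x g).
    { split; [discriminate|]. intros a Ha. unfold g.
      destruct (Nat.leb_spec a (length x)); [|lia]. now apply (init_tape_fill b x'). }
    exists g. enough (wp O0 (query_prog M CM N CN) (init_idx (length x), g)
      (fun s' => out cf = out (mk 0 s'))) as (s' & Hd & Ho) by eauto.
    apply wp_seq. eapply wp_mono; [|intros s1 H; apply wp_seq; exact H].
    apply wp_load_pad; [easy|]. intros s Hq H1 H5 Hz. apply wp_seq.
    eapply wp_mono; [apply HG; auto|].
    + fold x in H1, Hz. intros k a Hk Ha. rewrite H1, Hz by easy. unfold g.
      destruct (Nat.leb_spec (guess_addr (length x) k a) (length x)) as [H|H].
      * unfold guess_addr, phi in H. nia.
      * now apply guess_tape_addr.
    + intros s3 Hq3. eapply wp_mono; [apply wp_unload|]. intros s' Ho. simpl in Ho. rewrite Ho.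
      symmetry. now apply query_unload_out.
Qed.

(** * Register bounds of the simulating programs and the two inclusions *)

Lemma reset_wf ok tau b K : b + K < tau -> wf ok tau (reset b K).
Proof. induction K; simpl; [easy|]. intros H. split; [lia|]. apply IHK. lia. Qed.

(** Bookkeeping takes registers below 21, the index registers of [M] start at 21 and those of [N] at
    [21 + nidx M]; this yields the value of [tau]. *)
Lemma query_prog_wf : 1 <= CM -> 1 <= CN ->
  wf false (21 + nidx M + nidx N) (query_prog M CM N CN).
Proof.
  intros H1 H2. set (tau := 21 + nidx M + nidx N).
  assert (HK : 1 <= nidx M /\ 1 <= nidx N) by (split; [apply HM|apply HN]).
  assert (HlM : 1 <= length (prog M)).
  { destruct HM as (_ & (P0 & -> & _) & _). rewrite length_app. simpl. lia. }
  assert (HlN : 1 <= length (prog N)).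
  { destruct HN as (_ & (P0 & -> & _) & _). rewrite length_app. simpl. lia. }
  assert (Hsim : wf false tau (sim_step N (20 + nidx M) 9 2 (fun _ => Skip))).
  { apply sim_step_wf with false; auto; unfold tau; try lia. intros; exact I. }
  assert (Hres : wf false tau (reset (20 + nidx M) (nidx N)))
    by (apply reset_wf; unfold tau; lia).
  assert (Hans : forall j, 1 <= j -> wf false tau (answer M N CN j)).
  { intros j Hj. unfold answer, search, for_lengths, attempt, setup, run, for_copy.
    cbn [wf ewf phie guess_expr incpc]. unfold phi, tau in *. repeat split; try lia; auto. }
  assert (HsimM : wf false tau (sim_step M 20 2 1 (answer M N CN))).
  { apply sim_step_wf with true; auto; unfold tau; lia. }
  unfold query_prog, load, pad, query_step, pad_next, unload, for_copy.
  cbn [wf ewf phie]. unfold tau in *. repeat split; try lia; auto.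
Qed.
End Correctness.

Lemma guess_prog_wf (M : machine A) C : wf_machine A false M ->
  wf true (21 + nidx M) (guess_prog M C).
Proof.
  intros HM. assert (HK : 1 <= nidx M) by apply HM.
  assert (Hl : 1 <= length (prog M)).
  { destruct HM as (_ & (P0 & -> & _) & _). rewrite length_app. simpl. lia. }
  assert (Hsim : wf true (21 + nidx M) (sim_step M 20 2 1 (fun _ => Skip))).
  { apply sim_step_wf with false; auto; try lia. intros; exact I. }
  assert (Hnext : wf true (21 + nidx M) guess_next).
  { cbn [wf ewf phie guess_next]. repeat split; lia. }
  assert (Hit : wf true (21 + nidx M) (Nat.iter C (Seq guess_next) Skip)).
  { induction C; simpl; [easy|]. split; [exact Hnext|easy]. }
  unfold guess_prog, load, guess_step, unload, for_copy.
  cbn [wf ewf phie]. repeat split; try lia; auto; simpl; lia.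
Qed.

Lemma init_idx_pos n r : 1 <= n -> 1 <= init_idx n r.
Proof. intros Hn. unfold init_idx. destruct (Nat.eqb r 1); lia. Qed.

Lemma nu_sub_ND Q M : SDEC A Q -> nu_machine A M ->
  exists M', ND_machine A M' /\ forall x y, Res_nu A Q M x y <-> Res_ND A M' x y.
Proof.
  intros (N & HN & HQ) HM.
  destruct (zbound_exists (prog M)) as (CM & HCM1 & HCM).
  destruct (zbound_exists (prog N)) as (CN & HCN1 & HCN).
  destruct (compile false (21 + nidx M + nidx N) (query_prog M CM N CN)) as (M' & HM' & H).
  { lia. }
  { now apply query_prog_wf. }
  exists M'. split; [exact HM'|]. intros x y.
  rewrite (Res_ND_stream M' x y HM').
  rewrite <- (query_prog_correct M CM HM HCM N CN HN HCN Q HQ x y).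
  assert (Hpos : forall g : nat -> U, init_tape x g ->
    forall r, 1 <= fst (init_idx (length x), g) r).
  { intros g [Hx _] r. apply init_idx_pos. destruct x; simpl; [easy|lia]. }
  split.
  - intros (g & s' & Hg & Hd & Hy).
    destruct (proj2 (H (fun _ _ => False) _ y (Hpos g Hg))) as (cf & Hr & Hf); eauto.
  - intros (g & cf & Hg & Hr & Hf & Hy).
    destruct (proj1 (H (fun _ _ => False) _ y (Hpos g Hg))) as (s' & Hd & Hs); eauto.
Qed.

Lemma ND_sub_nu M' : ND_machine A M' ->
  exists M, nu_machine A M /\ forall x y, Res_nu A (Uinf A) M x y <-> Res_ND A M' x y.
Proof.
  intros HM'. destruct (zbound_exists (prog M')) as (C & HC1 & HC).
  destruct (compile true (21 + nidx M') (guess_prog M' C)) as (M & HM & H).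
  { lia. }
  { now apply guess_prog_wf. }
  exists M. split; [exact HM|]. intros x y. rewrite (Res_ND_stream M' x y HM').
  destruct x as [|b x'].
  { split; [now intros (c0 & cf & [] & _)|now intros (g & cf & [Hx _] & _)]. }
  set (x := b :: x').
  rewrite (guess_prog_correct M' C HM' HC x y _ (init_tape_fill b x')).
  rewrite <- H.
  - split.
    + intros (c0 & cf & -> & Hr & Hf & Hy). exists cf. repeat split; auto.
    + intros (cf & Hr & Hf & Hy). eexists; exists cf. split; [reflexivity|auto].
  - intros r. apply init_idx_pos. simpl. lia.
Qed.

(** A program consisting of the stop instruction halts on every tuple, while the empty list has no
    initial configuration. *)
Lemma SDEC_Uinf : SDEC A (Uinf A).
Proof.
  exists {| nidx := 1; prog := [IStop] |}. split.
  - split; [easy|]. split.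
    + exists []. split; [easy|]. now intros ins [].
    + intros ins [<-|[]]. exact I.
  - intros [|b x]; split.
    + now intros H.
    + now intros (c0 & c & [] & _).
    + intros _. eexists; eexists. split; [reflexivity|]. split; [apply rt_refl|reflexivity].
    + intros _. discriminate.
Qed.

End Structure.

Theorem mainTheorem3 (A : structure) :
  (forall Q : list (univ A) -> Prop,
     (forall x, Q x -> Uinf A x) -> SDEC A Q ->
     forall M, nu_machine A M ->
       exists M', ND_machine A M' /\
         forall x y, Res_nu A Q M x y <-> Res_ND A M' x y) /\
  (forall M, nu_machine A M ->
     exists M', ND_machine A M' /\
       forall x y, Res_nu A (Uinf A) M x y <-> Res_ND A M' x y) /\
  (forall M', ND_machine A M' ->
     exists M, nu_machine A M /\
       forall x y, Res_nu A (Uinf A) M x y <-> Res_ND A M' x y).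
Proof.
  split; [|split].
  - intros Q _ HQ M HM. now apply nu_sub_ND.
  - intros M HM. apply nu_sub_ND; [apply SDEC_Uinf|exact HM].
  - apply ND_sub_nu.
Qed.
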